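(* For every group $G$ there is an isomorphism $HQ_1(\mathbb{F}_2[G])\cong\Sigma(G)$, where $$\Sigma(G)=\bigoplus_{z\in S_1}\bigl(((G_z)_\#/\langle z\rangle)\times C_2\bigr)\oplus\bigoplus_{z\in S_2}\frac{(\overline{G_z}\times_{C_2}C_4)_\#}{\langle[z,t^2]\rangle}\oplus\bigoplus_{z\in S_3^+}(G_z)_\#.$$
   Context: $HQ_1$: for a ring $B$ with anti-involution $x\mapsto\bar x$, $\otimes=\otimes_{\mathbb Z}$ and $b(r\otimes s)=rs-sr$, $HQ_1(B)$ is the quotient of $\{(\xi,c)\in(B\otimes B)\oplus B\mid b(\xi)+c-\bar c=0\}$ by the subgroup generated by all $(r\otimes s+s\otimes r,-rs-\overline{rs})$, $(u\otimes v+\bar u\otimes\bar v,vu-uv)$, $(0,2(w+\bar w))$, $(xy\otimes z-x\otimes yz+zx\otimes y,0)$ (this is the degree one homology of the quaternionic double complex). Here $B=\mathbb{F}_2[G]$ with $\bar g=g^{-1}$. Let $\Gamma$ be the set of conjugacy classes of $G$, $C(g)$ the class of $g$, and $S\colon\Gamma\to G$ a section of $C$ such that $S(C(g^{-1}))=S(C(g))^{-1}$ whenever $C(g)\ne C(g^{-1})$. An element $z$ is of type 1 if $z=z^{-1}$, of type 2 if $z^{-1}\in C(z)$ and $z\ne z^{-1}$, of type 3 if $z^{-1}\notin C(z)$. $S_i$ is the set of elements of type $i$ in the image of $S$; $S_3$ is written as a disjoint union $S_3^+\sqcup S_3^-$ with $z\in S_3^+\Leftrightarrow z^{-1}\in S_3^-$.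 $G_z$ is the centralizer of $z$, $\overline{G_z}=\{g\in G\mid g^{-1}zg\in\{z,z^{-1}\}\}$. For a group $J$, $J_\#=J_{\mathrm{ab}}/(J_{\mathrm{ab}})^2$. $C_m$ is the cyclic group of order $m$. For $z$ of type 2, $\overline{G_z}\times_{C_2}C_4$ is the fibre product of the homomorphism $\overline{G_z}\to C_2$ with kernel $G_z$ and the surjection $C_4\to C_2$; $t$ is a generator of $C_4$. $\langle\,\cdot\,\rangle$ denotes the subgroup generated by the class of the indicated element. *)

(* Defs.v *)
From HB Require Import structures.
From mathcomp Require Import all_boot ssralg ssrnum ssrint zmodp.
From mathcomp Require Import generic_quotient ring_quotient.
From mathcomp Require Import boolp classical_sets cardinality.
From mathcomp Require Import finmap monalg.

Set Implicit Arguments.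
Unset Strict Implicit.
Unset Printing Implicit Defensive.

Import GRing.Theory.
Local Open Scope classical_set_scope.
Local Open Scope quotient_scope.
Local Open Scope ring_scope.

Section GeneratedQuotient.
Variable V : zmodType.

(* Smallest subgroup containing X. *)
Inductive zspan_spec (X : set V) : V -> Prop :=
| ZspanIn v : X v -> zspan_spec X v
| Zspan0 : zspan_spec X 0
| ZspanB u v : zspan_spec X u -> zspan_spec X v -> zspan_spec X (u - v).

Definition zspan (X : set V) : {pred V} := fun v => `[< zspan_spec X v >].

Lemma zspan_closed (X : set V) : zmod_closed (zspan X).
Proof.
split=> [|u v /asboolP Xu /asboolP Xv]; apply/asboolP; first exact: Zspan0.
exact: ZspanB.
Qed.

HB.instance Definition _ (X : set V) :=
  GRing.isZmodClosed.Build V (zspan X) (zspan_closed X).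

Definition zquot (X : set V) := Quotient.quot (zspan X).
HB.instance Definition _ (X : set V) := GRing.Zmodule.on (zquot X).

Definition zclass (X : set V) : V -> zquot X := \pi_(Quotient.quot (zspan X)).

Lemma zclassB (X : set V) : zmod_morphism (@zclass X).
Proof. exact: raddfB. Qed.
HB.instance Definition _ (X : set V) :=
  GRing.isZmodMorphism.Build V (zquot X) (@zclass X) (@zclassB X).

Lemma zclass_eq (X : set V) u v :
  zclass X u = zclass X v <-> zspan_spec X (u - v).
Proof.
by split=> [/eqP|uv]; [|apply/eqP]; rewrite -Quotient.idealrBE => *;
  apply/asboolP.
Qed.

Lemma zclass_repr (X : set V) (x : zquot X) : zclass X (repr x) = x.
Proof. exact: reprK. Qed.

End GeneratedQuotient.

(* Tensor product over Z, as a quotient of {malg A * C}, the free abelian group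
   on A * C. *)
Section Tensor.
Variables A C : zmodType.

Local Notation free := {malg (A * C)%type}.

Inductive tensor_rel : free -> Prop :=
| TensorDl a a' c :
    tensor_rel (<< (a + a', c) >> - << (a, c) >> - << (a', c) >>)
| TensorDr a c c' :
    tensor_rel (<< (a, c + c') >> - << (a, c) >> - << (a, c') >>).

Definition tensor : zmodType := zquot tensor_rel.

Definition tens (a : A) (c : C) : tensor := zclass tensor_rel << (a, c) >>.

Lemma tensDl a a' c : tens (a + a') c = tens a c + tens a' c.
Proof.
rewrite /tens -raddfD /=; apply/zclass_eq/ZspanIn.
by rewrite opprD addrA; exact: TensorDl.
Qed.

Lemma tensDr a c c' : tens a (c + c') = tens a c + tens a c'.
Proof.
rewrite /tens -raddfD /=; apply/zclass_eq/ZspanIn.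
by rewrite opprD addrA; exact: TensorDr.
Qed.

End Tensor.

(* For biadditive f, tensor_lift f is the induced homomorphism out of the
   tensor product (tensor_liftE, tensor_liftB); otherwise it depends on the
   representatives picked by repr. *)
Section TensorLift.
Variables (A C D : zmodType) (f : A -> C -> D).

Definition free_lift (x : {malg (A * C)%type}) : D :=
  \sum_(k <- msupp x) f k.1 k.2 *~ x@_k.

Definition tensor_lift (x : tensor A C) : D := free_lift (repr x).

Lemma free_liftEw (d : {fset (A * C)%type}) x : (msupp x `<=` d)%fset ->
  free_lift x = \sum_(k <- d) f k.1 k.2 *~ x@_k.
Proof.
move=> le_d; apply/big_fset_incl => // k _ /mcoeff_outdom ->.
by rewrite mulr0z.
Qed.

Lemma free_liftB : zmod_morphism free_lift.
Proof.
move=> x y; have lex := fsubsetUl (msupp x) (msupp y).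
have ley := fsubsetUr (msupp x) (msupp y).
rewrite (free_liftEw lex) (free_liftEw ley) (free_liftEw (msuppB_le x y)).
by rewrite -sumrB; apply: eq_bigr => k _; rewrite mcoeffB mulrzBr.
Qed.
HB.instance Definition _ :=
  GRing.isZmodMorphism.Build {malg (A * C)%type} D free_lift free_liftB.

Lemma free_liftU k : free_lift << k >> = f k.1 k.2.
Proof.
by rewrite (free_liftEw msuppU_le) big_seq_fset1 mcoeffUU mulr1z.
Qed.

Hypothesis fDl : forall a a' c, f (a + a') c = f a c + f a' c.
Hypothesis fDr : forall a c c', f a (c + c') = f a c + f a c'.

Lemma free_lift_rel x : zspan_spec (@tensor_rel A C) x -> free_lift x = 0.
Proof.
elim=> {x} [_ [a a' c|a c c']||x y _ fx _ fy]; last 2 first.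
- by rewrite raddf0.
- by rewrite raddfB /= fx fy subr0.
- by rewrite !raddfB /= !free_liftU /= fDl addrAC addrK subrr.
- by rewrite !raddfB /= !free_liftU /= fDr addrAC addrK subrr.
Qed.

Lemma tensor_lift_class x : tensor_lift (zclass (@tensor_rel A C) x) = free_lift x.
Proof.
apply/eqP; rewrite -subr_eq0 -raddfB /=; apply/eqP/free_lift_rel/zclass_eq.
exact: zclass_repr.
Qed.

Lemma tensor_liftE a c : tensor_lift (tens a c) = f a c.
Proof. by rewrite tensor_lift_class free_liftU. Qed.

Lemma tensor_liftB : zmod_morphism tensor_lift.
Proof.
move=> x y; rewrite -[x]zclass_repr -[y]zclass_repr -raddfB /=.
by rewrite !tensor_lift_class raddfB.
Qed.

End TensorLift.

HB.mixin Record PzRing_hasAntiInvolution B of GRing.PzRing B := {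
  bar : B -> B;
  barD : {morph bar : x y / x + y};
  barM : forall x y, bar (x * y) = bar y * bar x;
  barK : involutive bar
}.

#[short(type="antiInvRingType")]
HB.structure Definition AntiInvRing :=
  { B of PzRing_hasAntiInvolution B & GRing.PzRing B }.

Section HQ1.
Variable B : antiInvRingType.

Local Notation BB := (tensor B B).

Lemma bar0 : bar (0 : B) = 0.
Proof. by apply: (addrI (bar 0)); rewrite -barD !addr0. Qed.

Lemma barN (x : B) : bar (- x) = - bar x.
Proof. by apply/eqP; rewrite -addr_eq0 -barD addNr bar0. Qed.

Lemma barB (x y : B) : bar (x - y) = bar x - bar y.
Proof. by rewrite barD barN. Qed.

Definition hqb : BB -> B := tensor_lift (fun r s : B => r * s - s * r).

Let hqbDl (r r' s : B) : (r + r') * s - s * (r + r') =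
  (r * s - s * r) + (r' * s - s * r').
Proof. by rewrite mulrDl mulrDr opprD addrACA. Qed.

Let hqbDr (r s s' : B) : r * (s + s') - (s + s') * r =
  (r * s - s * r) + (r * s' - s' * r).
Proof. by rewrite mulrDl mulrDr opprD addrACA. Qed.

Lemma hqbE r s : hqb (tens r s) = r * s - s * r.
Proof. by rewrite /hqb tensor_liftE. Qed.

Lemma hqb_zmod : zmod_morphism hqb.
Proof. exact: tensor_liftB. Qed.
HB.instance Definition _ := GRing.isZmodMorphism.Build BB B hqb hqb_zmod.

Definition hq1_cycle : {pred BB * B} :=
  fun u => hqb u.1 + u.2 - bar u.2 == 0.

Lemma hq1_cycle_closed : zmod_closed hq1_cycle.
Proof.
split=> [|u v /eqP u0 /eqP v0]; apply/eqP.
  by rewrite raddf0 bar0 subr0 addr0.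
rewrite raddfB /= barB addrACA -opprD opprB [bar v.2 - _]addrC addrACA.
by rewrite u0 add0r addrC -opprB v0 oppr0.
Qed.
HB.instance Definition _ :=
  GRing.isZmodClosed.Build (BB * B)%type hq1_cycle hq1_cycle_closed.

Record hq1_cycles := HQ1Cycle { hq1_val :> BB * B; _ : hq1_val \in hq1_cycle }.
HB.instance Definition _ := [isSub for hq1_val].
HB.instance Definition _ := [Choice of hq1_cycles by <:].
HB.instance Definition _ := [SubChoice_isSubZmodule of hq1_cycles by <:].

Inductive hq1_rel : BB * B -> Prop :=
| HQ1RelSym (r s : B) :
    hq1_rel (tens r s + tens s r, - (r * s) - bar (r * s))
| HQ1RelBar (u v : B) :
    hq1_rel (tens u v + tens (bar u) (bar v), v * u - u * v)
| HQ1RelTrace (w : B) : hq1_rel (0, (w + bar w) *+ 2)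
| HQ1RelHoch (x y z : B) :
    hq1_rel (tens (x * y) z - tens x (y * z) + tens (z * x) y, 0).

(* Every relator is a cycle, so no relator is lost in the preimage used in HQ1. *)
Lemma hq1_rel_cycle u : hq1_rel u -> u \in hq1_cycle.
Proof.
case=> [r s|u' v|w|x y z]; rewrite unfold_in /=; apply/eqP.
- rewrite raddfD /= !hqbE -[s * r - _]opprB subrr add0r barB barN barK.
  by rewrite opprB opprK -opprD addNr.
- rewrite raddfD /= !hqbE barB !barM -[v * u' - _]opprB.
  by rewrite [_ + - (u' * v - _)]addrAC subrr add0r subrr.
- by rewrite raddf0 add0r !mulr2n !barD barK [bar w + w]addrC subrr.
rewrite bar0 subr0 addr0 raddfD raddfB /= !hqbE !mulrA opprB.
by rewrite [_ + (y * z * x - _)]addrC subrKA subrKA subrr.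
Qed.

(* Degree one homology of the quaternionic double complex. *)
Definition HQ1 : zmodType := zquot [set u : hq1_cycles | hq1_rel (val u)].

End HQ1.

Definition grpring (R : comNzRingType) (G : groupType) := {malg R[G]}.

Section GroupRing.
Variables (R : comNzRingType) (G : groupType).

HB.instance Definition _ := GRing.Zmodule.on (grpring R G).

Implicit Types (a b c : grpring R G) (g h : G).

Definition grpmon (x : R) g : grpring R G := << x *g g >>.

Definition grpring1 : grpring R G := grpmon 1 1%g.

Definition grpring_mul a b : grpring R G :=
  \sum_(g <- msupp a) \sum_(h <- msupp b) grpmon (a@_g * b@_h) (g * h)%g.

Definition grpring_bar a : grpring R G :=
  \sum_(g <- msupp a) grpmon a@_g (g^-1)%g.

Lemma grpmon0 g : grpmon 0 g = 0.
Proof. exact: monalgU0. Qed.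

Lemma grpmonD x y g : grpmon (x + y) g = grpmon x g + grpmon y g.
Proof. exact: monalgUD. Qed.

Lemma grpring_mulEw (d1 d2 : {fset G}) a b :
  (msupp a `<=` d1)%fset -> (msupp b `<=` d2)%fset -> grpring_mul a b =
  \sum_(g <- d1) \sum_(h <- d2) grpmon (a@_g * b@_h) (g * h)%g.
Proof.
move=> le_d1 le_d2; rewrite /grpring_mul (big_fset_incl _ le_d1) /=.
  apply/eq_bigr=> g _; apply/big_fset_incl => // h _ /mcoeff_outdom ->.
  by rewrite mulr0 grpmon0.
by move=> g _ /mcoeff_outdom ag; rewrite big1 // => h _; rewrite ag mul0r grpmon0.
Qed.

Lemma grpring_mulUU x y g h :
  grpring_mul (grpmon x g) (grpmon y h) = grpmon (x * y) (g * h)%g.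
Proof. by rewrite (grpring_mulEw msuppU_le msuppU_le) !big_seq_fset1 !mcoeffUU. Qed.

Lemma grpring_mulDl : left_distributive grpring_mul +%R.
Proof.
move=> a b c; have leab := msuppD_le a b.
rewrite (grpring_mulEw leab (fsubset_refl _)).
rewrite (grpring_mulEw (fsubsetUl _ (msupp b)) (fsubset_refl (msupp c))).
rewrite (grpring_mulEw (fsubsetUr (msupp a) _) (fsubset_refl (msupp c))).
rewrite -big_split /=; apply/eq_bigr=> g _.
rewrite -big_split /=; apply/eq_bigr=> h _.
by rewrite mcoeffD mulrDl grpmonD.
Qed.

Lemma grpring_mulDr : right_distributive grpring_mul +%R.
Proof.
move=> c a b; have leab := msuppD_le a b.
rewrite (grpring_mulEw (fsubset_refl _) leab).
rewrite (grpring_mulEw (fsubset_refl (msupp c)) (fsubsetUl _ (msupp b))).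
rewrite (grpring_mulEw (fsubset_refl (msupp c)) (fsubsetUr (msupp a) _)).
rewrite -big_split /=; apply/eq_bigr=> g _.
rewrite -big_split /=; apply/eq_bigr=> h _.
by rewrite mcoeffD mulrDr grpmonD.
Qed.

Lemma grpring_mul_suml (r : seq G) (F : G -> grpring R G) b :
  grpring_mul (\sum_(i <- r) F i) b = \sum_(i <- r) grpring_mul (F i) b.
Proof.
apply: (big_morph (grpring_mul^~ b)) => [x y|]; first exact: grpring_mulDl.
by rewrite /grpring_mul msupp0 big_seq_fset0.
Qed.

Lemma grpring_mul_sumr (r : seq G) (F : G -> grpring R G) a :
  grpring_mul a (\sum_(i <- r) F i) = \sum_(i <- r) grpring_mul a (F i).
Proof.
apply: (big_morph (grpring_mul a)) => [x y|]; first exact: grpring_mulDr.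
by rewrite /grpring_mul big1 // => g _; rewrite msupp0 big_seq_fset0.
Qed.

Lemma grpringE a : a = \sum_(g <- msupp a) grpmon a@_g g.
Proof. exact: monalgE. Qed.

Lemma grpring_mulEl a b :
  grpring_mul a b = \sum_(g <- msupp a) grpring_mul (grpmon a@_g g) b.
Proof. by rewrite {1}(grpringE a) grpring_mul_suml. Qed.

Lemma grpring_mulEr a b :
  grpring_mul a b = \sum_(g <- msupp b) grpring_mul a (grpmon b@_g g).
Proof. by rewrite {1}(grpringE b) grpring_mul_sumr. Qed.

Lemma grpring_mulA : associative grpring_mul.
Proof.
move=> a b c.
rewrite (grpring_mulEl a) [in RHS](grpring_mulEl a) [RHS]grpring_mul_suml.
apply: eq_bigr => g _.
rewrite (grpring_mulEl b) (grpring_mulEr _ b).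
rewrite [LHS]grpring_mul_sumr [RHS]grpring_mul_suml; apply: eq_bigr => h _.
rewrite (grpring_mulEr _ c) [RHS]grpring_mulEr [LHS]grpring_mul_sumr.
by apply: eq_bigr => k _; rewrite !grpring_mulUU mulrA mulgA.
Qed.

Lemma grpring_mul1l : left_id grpring1 grpring_mul.
Proof.
move=> a; rewrite grpring_mulEr [RHS]grpringE; apply: eq_bigr => g _.
by rewrite grpring_mulUU mul1r mul1g.
Qed.

Lemma grpring_mul1r : right_id grpring1 grpring_mul.
Proof.
move=> a; rewrite grpring_mulEl [RHS]grpringE; apply: eq_bigr => g _.
by rewrite grpring_mulUU mulr1 mulg1.
Qed.

HB.instance Definition _ := GRing.Zmodule_isPzRing.Build (grpring R G)
  grpring_mulA grpring_mul1l grpring_mul1r grpring_mulDl grpring_mulDr.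

Lemma grpring_barE a :
  grpring_bar a = \sum_(g <- msupp a) grpmon a@_g (g^-1)%g.
Proof. by []. Qed.

Lemma grpring_barEw (d : {fset G}) a : (msupp a `<=` d)%fset ->
  grpring_bar a = \sum_(g <- d) grpmon a@_g (g^-1)%g.
Proof.
move=> le_d; apply/big_fset_incl => // g _ /mcoeff_outdom ->.
by rewrite grpmon0.
Qed.

Lemma grpring_barU x g : grpring_bar (grpmon x g) = grpmon x (g^-1)%g.
Proof. by rewrite (grpring_barEw msuppU_le) big_seq_fset1 mcoeffUU. Qed.

Lemma grpring_barD : {morph grpring_bar : a b / a + b}.
Proof.
move=> a b; rewrite (grpring_barEw (msuppD_le a b)).
rewrite (grpring_barEw (fsubsetUl _ (msupp b))).
rewrite (grpring_barEw (fsubsetUr (msupp a) _)) -big_split /=.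
by apply: eq_bigr => g _; rewrite mcoeffD grpmonD.
Qed.

Lemma grpring_bar_sum (r : seq G) (F : G -> grpring R G) :
  grpring_bar (\sum_(i <- r) F i) = \sum_(i <- r) grpring_bar (F i).
Proof.
apply: (big_morph grpring_bar) => [x y|]; first exact: grpring_barD.
by rewrite /grpring_bar msupp0 big_seq_fset0.
Qed.

Lemma grpring_barM a b : grpring_bar (a * b) = grpring_bar b * grpring_bar a.
Proof.
have -> : a * b = grpring_mul a b by [].
have -> : grpring_bar b * grpring_bar a =
  grpring_mul (grpring_bar b) (grpring_bar a) by [].
rewrite (grpring_mulEl a) grpring_bar_sum [grpring_bar a]grpring_barE.
rewrite [RHS]grpring_mul_sumr; apply: eq_bigr => g _.
rewrite grpring_mulEr grpring_bar_sum [grpring_bar b]grpring_barE.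
rewrite [RHS]grpring_mul_suml; apply: eq_bigr => h _.
by rewrite grpring_mulUU !grpring_barU grpring_mulUU mulrC invgM.
Qed.

Lemma grpring_barK : involutive grpring_bar.
Proof.
move=> a; rewrite [grpring_bar a]grpring_barE grpring_bar_sum [RHS]grpringE.
by apply: eq_bigr => g _; rewrite !grpring_barU invgK.
Qed.

HB.instance Definition _ := PzRing_hasAntiInvolution.Build (grpring R G)
  grpring_barD grpring_barM grpring_barK.

End GroupRing.

(* The abelianization of a multiplicative group J is written additively, so
   (J_ab)^2 below is the subgroup generated by the u + u. *)
Section Abelianization.
Variable J : groupType.

Inductive commutator_subgroup : J -> Prop :=
| CommSubR x y : commutator_subgroup [~ x, y]%g
| CommSub1 : commutator_subgroup 1%g
| CommSubM x y : commutator_subgroup x -> commutator_subgroup y ->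
    commutator_subgroup (x * y)%g
| CommSubV x : commutator_subgroup x -> commutator_subgroup (x^-1)%g.

Lemma commutator_subgroupJ x y :
  commutator_subgroup x -> commutator_subgroup (x ^ y)%g.
Proof.
move=> Dx; rewrite -[(x ^ y)%g](mulVKg x); apply: CommSubM => //.
exact: CommSubR.
Qed.

Definition abel_rel (x y : J) : bool := `[< commutator_subgroup (x * y^-1)%g >].

Lemma abel_rel_equiv : equiv_class_of abel_rel.
Proof.
have sym x y : abel_rel x y -> abel_rel y x.
  by move=> /asboolP/CommSubV Dxy; apply/asboolP; rewrite invgM invgK in Dxy.
split=> [x|x y|y x z].
- by apply/asboolP; rewrite mulgV; exact: CommSub1.
- by apply/idP/idP; exact: sym.
- move=> /asboolP Dxy /asboolP Dyz; apply/asboolP.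
  by have := CommSubM Dxy Dyz; rewrite mulgA mulgVK.
Qed.

Canonical abel_rel_equivRel := EquivRelPack abel_rel_equiv.

Definition abelz := {eq_quot abel_rel}.
HB.instance Definition _ := Choice.on abelz.

Definition abel : J -> abelz := \pi_({eq_quot abel_rel}).

Lemma abel_eq x y : abel x = abel y <-> commutator_subgroup (x * y^-1)%g.
Proof.
split=> [/eqmodP/asboolP //|Dxy].
by apply/eqmodP/asboolP.
Qed.

Lemma abel_repr (u : abelz) : abel (repr u) = u.
Proof. exact: reprK. Qed.

Definition abelz_zero : abelz := abel 1%g.
Definition abelz_add (u v : abelz) : abelz := abel (repr u * repr v)%g.
Definition abelz_opp (u : abelz) : abelz := abel (repr u)^-1%g.

Lemma abelM x y : abel (x * y)%g = abelz_add (abel x) (abel y).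
Proof.
have /abel_eq Dx := esym (abel_repr (abel x)).
have /abel_eq Dy := esym (abel_repr (abel y)).
apply/abel_eq; rewrite invgM.
have -> : (x * y * ((repr (abel y))^-1 * (repr (abel x))^-1) =
  (x / repr (abel x)) * (y / repr (abel y)) ^ (repr (abel x))^-1)%g.
  by rewrite conjgE invgK !mulgA mulgVK.
by apply: CommSubM => //; exact: commutator_subgroupJ.
Qed.

Lemma abelV x : abel x^-1%g = abelz_opp (abel x).
Proof.
have /abel_eq/CommSubV Dx := abel_repr (abel x).
apply/abel_eq; rewrite invgK.
have -> : (x^-1 * repr (abel x) = (repr (abel x) * x^-1) ^ x)%g.
  by rewrite conjgE mulgVK.
by apply: commutator_subgroupJ; apply/abel_eq; exact: abel_repr.
Qed.

Lemma abelz_addA : associative abelz_add.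
Proof.
move=> u v w; rewrite -(abel_repr u) -(abel_repr v) -(abel_repr w).
by rewrite -!abelM mulgA.
Qed.

Lemma abelz_addC : commutative abelz_add.
Proof.
move=> u v; rewrite -(abel_repr u) -(abel_repr v) -!abelM; apply/abel_eq.
have -> : (repr u * repr v * (repr v * repr u)^-1 =
  [~ (repr u)^-1, (repr v)^-1])%g by rewrite commgEl conjgE !invgK invgM !mulgA.
exact: CommSubR.
Qed.

Lemma abelz_add0 : left_id abelz_zero abelz_add.
Proof. by move=> u; rewrite -(abel_repr u) -abelM mul1g. Qed.

Lemma abelz_addN : left_inverse abelz_zero abelz_opp abelz_add.
Proof. by move=> u; rewrite -(abel_repr u) -abelV -abelM mulVg. Qed.

HB.instance Definition _ := GRing.isZmodule.Build abelz
  abelz_addA abelz_addC abelz_add0 abelz_addN.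

Lemma abelMD x y : abel (x * y)%g = abel x + abel y.
Proof. exact: abelM. Qed.

Definition sharp_rel : set abelz := [set u + u | u in [set: abelz]].

(* J_# = J_ab / (J_ab)^2 *)
Definition sharp : zmodType := zquot sharp_rel.

Definition to_sharp (x : J) : sharp := zclass sharp_rel (abel x).

End Abelianization.

Record subgrp (G : groupType) (H : {pred G}) (clH : group_closed H) :=
  SubGrp { subgrp_val :> G; _ : subgrp_val \in H }.

Section SubGrp.
Variables (G : groupType) (H : {pred G}) (clH : group_closed H).
HB.instance Definition _ := [isSub for @subgrp_val G H clH].
HB.instance Definition _ := [Choice of subgrp clH by <:].
HB.instance Definition _ := SubChoice_isSubGroup.Build G _ (subgrp clH) clH.
End SubGrp.

Section DirectSum.
Variables (I : Type) (A : I -> zmodType).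

Definition zprod := forall i, A i.
HB.instance Definition _ := Choice.on zprod.

Implicit Types f g : zprod.

Definition zprod_zero : zprod := fun i => 0.
Definition zprod_opp f : zprod := fun i => - f i.
Definition zprod_add f g : zprod := fun i => f i + g i.

Lemma zprod_addA : associative zprod_add.
Proof. by move=> f g h; apply: functional_extensionality_dep => i; exact: addrA. Qed.
Lemma zprod_addC : commutative zprod_add.
Proof. by move=> f g; apply: functional_extensionality_dep => i; exact: addrC. Qed.
Lemma zprod_add0 : left_id zprod_zero zprod_add.
Proof. by move=> f; apply: functional_extensionality_dep => i; exact: add0r. Qed.
Lemma zprod_addN : left_inverse zprod_zero zprod_opp zprod_add.
Proof. by move=> f; apply: functional_extensionality_dep => i; exact: addNr. Qed.

HB.instance Definition _ := GRing.isZmodule.Build zprod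
  zprod_addA zprod_addC zprod_add0 zprod_addN.

Definition finsupport : {pred zprod} :=
  fun f => `[< finite_set [set i | f i != 0] >].

Lemma finsupport_closed : zmod_closed finsupport.
Proof.
split=> [|f g /asboolP ff /asboolP fg]; apply/asboolP.
  by apply: sub_finite_set (finite_set0 I) => i /=; rewrite eqxx.
apply: (@sub_finite_set _ _ ([set i | f i != 0] `|` [set i | g i != 0])).
  move=> i /=; have [fi0|] := eqVneq (f i) 0; last by left.
  have [gi0|] := eqVneq (g i) 0; last by right.
  have -> : (f - g) i = f i - g i by [].
  by rewrite fi0 gi0 subr0 eqxx.
by rewrite finite_setU.
Qed.
HB.instance Definition _ :=
  GRing.isZmodClosed.Build zprod finsupport finsupport_closed.

Record dirsum := DirSum { dirsum_val : zprod; _ : dirsum_val \in finsupport }.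
HB.instance Definition _ := [isSub for dirsum_val].
HB.instance Definition _ := [Choice of dirsum by <:].
HB.instance Definition _ := [SubChoice_isSubZmodule of dirsum by <:].

End DirectSum.

Section Conjugacy.
Variable G : groupType.
Local Open Scope group_scope.

Definition conjugate (x y : G) : bool := `[< exists g, y = x ^ g >].

Lemma conjugate_equiv : equiv_class_of conjugate.
Proof.
have sym x y : conjugate x y -> conjugate y x.
  by move=> /asboolP[g ->]; apply/asboolP; exists g^-1; rewrite conjgK.
split=> [x|x y|y x z].
- by apply/asboolP; exists 1; rewrite conjg1.
- by apply/idP/idP; exact: sym.
- move=> /asboolP[g ->] /asboolP[h ->]; apply/asboolP.
  by exists (g * h); rewrite conjgM.
Qed.

Canonical conjugate_equivRel := EquivRelPack conjugate_equiv.

(* The set of conjugacy classes, as a quotient of G; cclass is g |-> C(g). *)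
Definition conj_class := {eq_quot conjugate}.

Definition cclass : G -> conj_class := \pi_({eq_quot conjugate}).

Definition type1 (z : G) : Prop := z = z^-1.
Definition type2 (z : G) : Prop := conjugate z z^-1 /\ z <> z^-1.
Definition type3 (z : G) : Prop := ~ conjugate z z^-1.

Definition S1 (S : conj_class -> G) : set G := [set z | range S z /\ type1 z].
Definition S2 (S : conj_class -> G) : set G := [set z | range S z /\ type2 z].
Definition S3 (S : conj_class -> G) : set G := [set z | range S z /\ type3 z].

End Conjugacy.

Section Centralizers.
Variables (G : groupType) (z : G).
Local Open Scope group_scope.

Definition centralizer : {pred G} := fun g => z ^ g == z.
Definition ext_centralizer : {pred G} := fun g => (z ^ g == z) || (z ^ g == z^-1).

Let conj_invK g : z ^ g = z -> z ^ g^-1 = z.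
Proof. by move=> zg; rewrite -[in LHS]zg conjgK. Qed.

Let conj_invV g : z ^ g = z^-1 -> z ^ g^-1 = z^-1.
Proof. by move=> zg; rewrite -[z in LHS]invgK conjVg -zg conjgK. Qed.

Lemma centralizer_closed : group_closed centralizer.
Proof.
split=> [|x y /eqP zx /eqP /conj_invK zy]; apply/eqP; first exact: conjg1.
by rewrite conjgM zx.
Qed.

Lemma ext_centralizer_closed : group_closed ext_centralizer.
Proof.
split=> [|x y]; rewrite !unfold_in /ext_centralizer ?conjg1 ?eqxx // conjgM.
case/orP=> /eqP-> /orP[/eqP/conj_invK zy|/eqP/conj_invV zy].
- by rewrite zy eqxx.
- by rewrite zy eqxx orbT.
- by rewrite conjVg zy eqxx orbT.
- by rewrite conjVg zy invgK eqxx.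
Qed.

Lemma centralizer_id : z \in centralizer.
Proof. by rewrite unfold_in /centralizer conjgE mulKg. Qed.

Lemma ext_centralizer_id : z \in ext_centralizer.
Proof. by rewrite unfold_in /ext_centralizer conjgE mulKg eqxx. Qed.

Definition Gz : groupType := subgrp centralizer_closed.
Definition eGz : groupType := subgrp ext_centralizer_closed.

Definition z_in_Gz : Gz := SubGrp centralizer_closed centralizer_id.
Definition z_in_eGz : eGz := SubGrp ext_centralizer_closed ext_centralizer_id.

(* The homomorphism to C_2 with kernel G_z; it is trivial when z = z^-1. *)
Definition eGz_sign (g : eGz) : 'Z_2 :=
  if val g \in centralizer then 0%R else 1%R.

(* 'Z_n is used as the cyclic group C_n: its groupType product is the addition,
   so C4gen ^+ 2 below is the residue 2. *)
Definition C4_to_C2 (c : 'Z_4) : 'Z_2 := inZp c.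

Lemma eGz_signM g h : eGz_sign (g * h) = (eGz_sign g + eGz_sign h)%R.
Proof.
case: g h => g g_in [h h_in]; rewrite /eGz_sign.
have -> : val (SubGrp ext_centralizer_closed g_in *
  SubGrp ext_centralizer_closed h_in) = g * h by [].
rewrite /= !unfold_in /centralizer conjgM.
have /orP[/eqP-> | /eqP zg] := g_in; first by rewrite eqxx add0r.
have /orP[/eqP zh | /eqP zh] := h_in.
  by rewrite zg conjVg zh eqxx addr0.
rewrite zg conjVg zh invgK eqxx.
by case: eqP => _; apply: val_inj.
Qed.

Lemma C4_to_C2M (c d : 'Z_4) : C4_to_C2 (c * d) = (C4_to_C2 c + C4_to_C2 d)%R.
Proof.
by case: c d => [[|[|[|[|//]]]] ?] [[|[|[|[|//]]]] ?]; apply: val_inj.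
Qed.

Definition fibre_prod : {pred eGz * 'Z_4} :=
  fun u => eGz_sign u.1 == C4_to_C2 u.2.

Lemma fibre_prod_closed : group_closed fibre_prod.
Proof.
have signV g : eGz_sign g^-1 = eGz_sign g.
  apply: (@addrI _ (eGz_sign g)); rewrite -eGz_signM mulgV /eGz_sign val1.
  rewrite unfold_in /centralizer conjg1 eqxx; case: ifP => _; exact: val_inj.
have toC2V c : C4_to_C2 c^-1 = C4_to_C2 c.
  by case: c => [[|[|[|[|//]]]] ?]; apply: val_inj.
split=> [|[g c] [h d] /eqP /= gc /eqP /= hd]; apply/eqP.
  by rewrite /eGz_sign val1 unfold_in /centralizer conjg1 eqxx; apply: val_inj.
by rewrite /= eGz_signM C4_to_C2M signV toC2V gc hd.
Qed.

Definition eGzC4 : groupType := subgrp fibre_prod_closed.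

Definition C4gen : 'Z_4 := Zp1.

Lemma zt2_fibre : (z_in_eGz, C4gen ^+ 2) \in fibre_prod.
Proof.
by rewrite unfold_in /fibre_prod /eGz_sign /= centralizer_id; apply/eqP/val_inj.
Qed.

Definition zt2 : eGzC4 := SubGrp fibre_prod_closed zt2_fibre.

Definition summand1 : zmodType :=
  (zquot [set to_sharp z_in_Gz] * 'Z_2)%type.
Definition summand2 : zmodType := zquot [set to_sharp zt2].
Definition summand3 : zmodType := sharp Gz.

End Centralizers.

Definition Sigma (G : groupType) (S : conj_class G -> G) (S3p : set G) : zmodType :=
  (dirsum (fun z : S1 S => summand1 (val z)) *
   dirsum (fun z : S2 S => summand2 (val z)) *
   dirsum (fun z : S3p => summand3 (val z)))%type.

(* Main.v *)
(** The relations of HQ1 present a groupoid. Let GG = G x C4 act on G on the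
right, (h, k) sending w to w^h if k is even and to (w^h)^-1 if k is odd. Read
g (x) h as an arrow hg -> gh labelled (h, 0) and the basis element w of the
second summand as an arrow w -> w^-1 labelled (1, 1). Up to signs, which do not
matter since every group involved has exponent 2, (xi, c) |-> b(xi) + c - bar c
is the boundary map on chains of arrows. The Hochschild relation is
multiplicativity of labels, the relation with bars says that inversion commutes
with conjugation, and the symmetrization relation says that the loop at w
labelled (w, 2) vanishes. Hence HQ1 is the direct sum, over the orbits of GG on
G, of the mod 2 abelianizations of the stabilizers modulo the class of (z, 2),
and these are the summands of Sigma. *)
Require Import Defs.
From HB Require Import structures.
From mathcomp Require Import all_boot ssralg ssrint zmodp.
From mathcomp Require Import generic_quotient.
From mathcomp Require Import boolp classical_sets cardinality.
From mathcomp Require Import finmap monalg.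

Set Implicit Arguments.
Unset Strict Implicit.
Unset Printing Implicit Defensive.

Import GRing.Theory.
Local Open Scope classical_set_scope.
Local Open Scope ring_scope.

(** * Groups of exponent 2, subgroups and quotients *)

Definition exponent2 (V : zmodType) : Prop := forall v : V, v + v = 0.

Section Exponent2.
Variables (V : zmodType) (V2 : exponent2 V).

Lemma oppr_exponent2 (v : V) : - v = v.
Proof. by apply/eqP; rewrite eq_sym -addr_eq0 V2. Qed.

Lemma exponent2_eq (u v : V) : u + v = 0 -> u = v.
Proof. by move/eqP; rewrite addr_eq0 oppr_exponent2 => /eqP. Qed.

(** The residue [c] acts as the natural number 0 or 1, so the carry in [1 + 1] has to be absorbed by
    [v + v = 0]. *)
Lemma mulrn_F2D (v : V) (c d : 'F_2) :
  v *+ (c + d)%R = v *+ c + v *+ d.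
Proof.
by case: c d => [[|[|//]] ?] [[|[|//]] ?]; rewrite ?addr0 ?add0r //= mulr2n.
Qed.

End Exponent2.

(** A [Prop]-valued form of subgroup, fit to be the motive of the inductions on generators below. *)
Definition subgroup_pred (V : zmodType) (P : V -> Prop) : Prop :=
  P 0 /\ forall u v, P u -> P v -> P (u - v).

Section SubgroupPred.
Variables (V : zmodType) (P : V -> Prop) (PV : subgroup_pred P).

Lemma subgroup_predD u v : P u -> P v -> P (u + v).
Proof.
have [P0 PB] := PV => Pu Pv; rewrite -[v]opprK; apply: (PB) => //.
by rewrite -sub0r; apply: PB.
Qed.

Lemma subgroup_pred_sum (I : eqType) (r : seq I) (F : I -> V) :
  (forall i, i \in r -> P (F i)) -> P (\sum_(i <- r) F i).
Proof.
move=> PF; rewrite big_seq; apply: big_ind => //; first by case: PV.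
exact: subgroup_predD.
Qed.

Lemma subgroup_predMz u (n : int) : P u -> P (u *~ n).
Proof.
have PMn k : P u -> P (u *+ k).
  elim: k => [|k IHk] Pu; first by case: PV.
  by rewrite mulrS; apply: subgroup_predD => //; apply: IHk.
case: PV => P0 PB Pu; case: n => n; first exact: PMn.
by rewrite NegzE mulrNz -sub0r; apply: PB => //; apply: PMn.
Qed.

End SubgroupPred.

Lemma zspan_spec_min (V : zmodType) (X : set V) (P : V -> Prop) v :
  subgroup_pred P -> (forall x, X x -> P x) -> zspan_spec X v -> P v.
Proof. by case=> P0 PB XP; elim=> //; auto. Qed.

Lemma subgroup_pred_eq (U V : zmodType) (f g : {additive U -> V}) :
  subgroup_pred (fun u => f u = g u).
Proof. by split=> [|u v fu fv]; rewrite ?raddf0 // !raddfB fu fv. Qed.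

Section QuotientLift.
Variables (V W : zmodType) (X : set V) (f : {additive V -> W}).
Hypothesis fX : forall x, X x -> f x = 0.

(** [f] is read off a chosen representative; two representatives of a class differ by an element of
    the span of [X], which [f] kills. *)
Lemma zquot_lift_subproof : zmod_morphism (fun x : zquot X => f (repr x)).
Proof.
move=> x y /=; apply/eqP; rewrite -raddfB -subr_eq0 -raddfB /=; apply/eqP.
apply: (zspan_spec_min (P := fun v => f v = 0)) fX _.
  exact: (subgroup_pred_eq f \0).
by apply/zclass_eq; rewrite raddfB /= !zclass_repr.
Qed.

Lemma zquot_lift :
  exists F : {additive zquot X -> W}, forall v, F (zclass X v) = f v.
Proof.
pose F : {additive zquot X -> W} := HB.pack (fun x : zquot X => f (repr x))
  (GRing.isZmodMorphism.Build _ _ _ zquot_lift_subproof).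
exists F => v; apply/eqP; rewrite /F /= -subr_eq0 -raddfB /=; apply/eqP.
apply: (zspan_spec_min (P := fun v => f v = 0)) fX _.
  exact: (subgroup_pred_eq f \0).
by apply/zclass_eq; rewrite !zclass_repr.
Qed.

End QuotientLift.

Lemma zquot_ind (V : zmodType) (X : set V) (P : zquot X -> Prop) :
  (forall v, P (zclass X v)) -> forall q, P q.
Proof. by move=> PX q; rewrite -[q]zclass_repr. Qed.

Lemma zclass_in (V : zmodType) (X : set V) v : X v -> zclass X v = 0.
Proof.
move=> Xv; rewrite -(raddf0 (zclass X : {additive _ -> _})).
by apply/zclass_eq/ZspanIn; rewrite subr0.
Qed.

Lemma tensor_ind (A C : zmodType) (P : tensor A C -> Prop) :
  subgroup_pred P -> (forall a c, P (tens a c)) -> forall x, P x.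
Proof.
move=> PS Pt; apply: zquot_ind => v; rewrite [v]monalgE.
have PcS : subgroup_pred (fun u => P (zclass (@tensor_rel A C) u)).
  by case: PS => P0 PB; split=> [|x y Px Py]; rewrite ?raddf0 ?raddfB //; auto.
apply: (subgroup_pred_sum PcS) => -[a c] _.
suff -> : << v@_(a, c) *g (a, c) >> = << (a, c) >> *~ v@_(a, c).
  by rewrite raddfMz /=; apply: subgroup_predMz => //; apply: Pt.
by rewrite -[in LHS](intz v@_(a, c)) -[_%:~R]/(1 *~ _) raddfMz.
Qed.

Section AdditivePair.
Variables (U V W : zmodType) (F : {additive (U * V)%type -> W}).

Lemma raddf_pair x c : F (x, c) = F (x, 0) + F (0, c).
Proof. by rewrite -raddfD; congr (F (_, _)); rewrite ?addr0 ?add0r. Qed.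

Lemma raddf_pairl x y : F (x + y, 0) = F (x, 0) + F (y, 0).
Proof. by rewrite -raddfD; congr (F (_, _)); rewrite ?addr0. Qed.

Lemma raddf_pairr x y : F (0, x + y) = F (0, x) + F (0, y).
Proof. by rewrite -raddfD; congr (F (_, _)); rewrite ?addr0. Qed.

End AdditivePair.

(** * The group ring over F_2 *)

Section GroupRingF2.
Variable G : groupType.
Local Notation B := (grpring 'F_2 G).

Definition gmon (g : G) : B := grpmon 1 g.

Lemma gmonM g h : gmon (g * h)%g = gmon g * gmon h.
Proof. by rewrite [RHS]grpring_mulUU mulr1. Qed.

Lemma bar_gmon g : bar (gmon g) = gmon g^-1%g.
Proof. exact: grpring_barU. Qed.

(** The coefficients are 0 or 1, so every element is a sum of group elements. *)
Lemma grpring_ind (P : B -> Prop) :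
  subgroup_pred P -> (forall g, P (gmon g)) -> forall a, P a.
Proof.
move=> PS Pg a; rewrite [a]grpringE; apply: (subgroup_pred_sum PS) => g _.
case: (a@_g) => [[|[|//]] lt2] /=.
  have -> : Ordinal lt2 = 0 by apply: val_inj.
  by rewrite grpmon0; case: PS.
by have -> : Ordinal lt2 = 1 by apply: val_inj.
Qed.

Lemma grpring_exponent2 : exponent2 B.
Proof.
move=> a; apply/malgP => g; rewrite mcoeffD mcoeff0.
by case: (a@_g) => [[|[|//]] ?]; apply: val_inj.
Qed.

(** Inherited from the right factor: twice [a (x) c] is [a (x) (c + c)], hence zero. *)
Lemma tensor_exponent2 (A : zmodType) : exponent2 (tensor A B).
Proof.
apply: tensor_ind => [|a c]; last first.
  rewrite -tensDr grpring_exponent2; apply: (addrI (tens a 0)).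
  by rewrite -tensDr !addr0.
by split=> [|u v u2 v2]; rewrite ?addr0 // addrACA -opprD u2 v2 subr0.
Qed.

Lemma oppr_grpring (a : B) : - a = a.
Proof. exact: (oppr_exponent2 grpring_exponent2). Qed.

Lemma oppr_tensor (A : zmodType) (x : tensor A B) : - x = x.
Proof. exact: (oppr_exponent2 (@tensor_exponent2 A)). Qed.

Section Extension.
Variables (V : zmodType) (V2 : exponent2 V) (phi : G -> V).

(** The linear extension of [phi] to the group ring. A coefficient acts through its residue 0 or 1,
    which is additive because [V] has exponent 2. *)
Definition gext (a : B) : V := \sum_(g <- msupp a) phi g *+ a@_g.

Lemma gextEw (d : {fset G}) a : (msupp a `<=` d)%fset ->
  gext a = \sum_(g <- d) phi g *+ a@_g.
Proof. by move=> le_d; apply: big_fset_incl => // g _ /mcoeff_outdom ->. Qed.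

Lemma gextD : {morph gext : a b / a + b}.
Proof.
move=> a b; rewrite (gextEw (msuppD_le a b)).
rewrite (gextEw (fsubsetUl _ (msupp b))) (gextEw (fsubsetUr (msupp a) _)).
rewrite -big_split /=; apply: eq_bigr => g _.
by rewrite mcoeffD (mulrn_F2D V2).
Qed.

Lemma gext_zmod : zmod_morphism gext.
Proof.
move=> a b; rewrite (oppr_exponent2 V2) oppr_grpring.
exact: gextD.
Qed.

Lemma gext_gmon g : gext (gmon g) = phi g.
Proof. by rewrite (gextEw msuppU_le) big_seq_fset1 mcoeffUU. Qed.

End Extension.

Section BilinearExtension.
Variables (V : zmodType) (V2 : exponent2 V) (phi : G -> G -> V).

Definition gext2 (a b : B) : V := gext (fun g => gext (phi g) b) a.

Lemma gext2Dl a a' b : gext2 (a + a') b = gext2 a b + gext2 a' b.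
Proof. exact: gextD. Qed.

Lemma gext2Dr a b b' : gext2 a (b + b') = gext2 a b + gext2 a b'.
Proof.
rewrite /gext2 -big_split /=; apply: eq_bigr => g _.
by rewrite gextD // mulrnDl.
Qed.

Lemma gext2_gmon g h : gext2 (gmon g) (gmon h) = phi g h.
Proof. by rewrite /gext2 !gext_gmon. Qed.

End BilinearExtension.

Local Notation chains := (tensor B B * B)%type.

Lemma chains_exponent2 : exponent2 chains.
Proof. by case=> x c; congr (_, _); rewrite ?tensor_exponent2 ?grpring_exponent2. Qed.

(** Over F_2 the tensors of group elements and the group elements of the second summand form a basis
    of [chains]. This lemma constructs additive maps from values on the basis; [chains_ind] shows
    that the basis generates. *)
Lemma chains_lift (V : zmodType) (phi : G -> G -> V) (psi : G -> V) :
  exponent2 V -> exists F : {additive chains -> V},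
    (forall g h, F (tens (gmon g) (gmon h), 0) = phi g h) /\
    (forall g, F (0, gmon g) = psi g).
Proof.
move=> V2; have gDl := gext2Dl V2 phi; have gDr := gext2Dr V2 phi.
pose F (u : chains) := tensor_lift (gext2 phi) u.1 + gext psi u.2.
have F_zmod : zmod_morphism F.
  move=> u v; rewrite /F (tensor_liftB gDl gDr) gext_zmod //.
  by rewrite opprD addrACA.
pose Fa : {additive chains -> V} :=
  HB.pack F (GRing.isZmodMorphism.Build _ _ _ F_zmod).
exists Fa; split=> [g h|g]; rewrite /Fa /= /F /=.
  by rewrite tensor_liftE // gext2_gmon [gext _ 0]big1 ?addr0 // => k _;
    rewrite mcoeff0.
rewrite gext_gmon; suff -> : tensor_lift (gext2 phi) 0 = 0 by rewrite add0r.
by rewrite -[X in tensor_lift _ X](subrr 0) (tensor_liftB gDl gDr) subrr.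
Qed.

Lemma chains_ind (P : chains -> Prop) : subgroup_pred P ->
  (forall g h, P (tens (gmon g) (gmon h), 0)) -> (forall g, P (0, gmon g)) ->
  forall u, P u.
Proof.
move=> PS Pt Pg [x c]; have [P0 PB] := PS.
have -> : (x, c) = (x, 0) + (0, c) by congr (_, _); rewrite ?addr0 ?add0r.
apply: (subgroup_predD PS).
  have Px : subgroup_pred (fun x => P (x, 0)).
    split=> // u v Pu Pv.
    have -> : (u - v, 0) = (u, 0) - (v, 0) :> chains.
      by congr (_, _); rewrite subrr.
    exact: PB.
  elim/tensor_ind: x => // a b; elim/grpring_ind: a => [|g].
    split=> [|a a' Pa Pa']; last first.
      rewrite oppr_grpring tensDl.
      exact: (subgroup_predD Px).
    suff -> : tens 0 b = 0 :> tensor B B by [].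
    by apply: (addrI (tens 0 b)); rewrite -tensDl !addr0.
  elim/grpring_ind: b => [|h]; last exact: Pt.
  split=> [|b b' Pb Pb']; last first.
    rewrite oppr_grpring tensDr.
    exact: (subgroup_predD Px).
  suff -> : tens (gmon g) 0 = 0 :> tensor B B by [].
  by apply: (addrI (tens (gmon g) 0)); rewrite -tensDr !addr0.
elim/grpring_ind: c => //; split=> // u v Pu Pv.
have -> : (0, u - v) = (0, u) - (0, v) :> chains.
  by congr (_, _); rewrite subrr.
exact: PB.
Qed.

End GroupRingF2.

(** * Relators evaluated on group elements *)

Section Relators.
Variables (G : groupType) (V : zmodType).
Local Notation B := (grpring 'F_2 G).
Local Notation chains := (tensor B B * B)%type.
Variables (V2 : exponent2 V) (F : {additive chains -> V}).

(** Meant for a relator seen as a function [R] of one of its ring variables. *)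
Lemma kill_from_gmon (R : B -> chains) : {morph R : a b / a + b} ->
  (forall g, F (R (gmon g)) = 0) -> forall a, F (R a) = 0.
Proof.
move=> RD Rg; apply: grpring_ind => //; split=> [|a b Ra Rb].
  suff -> : R 0 = 0 by rewrite raddf0.
  by apply: (addrI (R 0)); rewrite -RD !addr0.
by rewrite oppr_grpring RD raddfD /= Ra Rb.
Qed.

Local Notation arrow g h := (F (tens (gmon g) (gmon h), 0)).
Local Notation flip g := (F (0, gmon g)).

Hypothesis Fsym : forall r s : G,
  arrow r s + arrow s r = flip (r * s)%g + flip (r * s)^-1%g.
Hypothesis Fbar : forall u v : G,
  arrow u v + arrow u^-1%g v^-1%g = flip (v * u)%g + flip (u * v)%g.
Hypothesis Fhoch : forall x y z : G,
  arrow (x * y)%g z + arrow (z * x)%g y = arrow x (y * z)%g.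

(** Relators are additive in each ring variable, so the variables are replaced by group elements one
    at a time. Signs disappear, and the trace relator is zero because [B] has exponent 2. *)
Lemma hq1_rel_kill u : hq1_rel u -> F u = 0.
Proof.
have hochD (W : zmodType) (p p' q q' r r' s t v : W) :
    s = p + p' -> t = q + q' -> v = r + r' ->
    s - t + v = (p - q + r) + (p' - q' + r').
  move=> -> -> ->.
  by rewrite opprD [RHS]addrACA; congr (_ + _); exact: addrACA.
have pairD (x x' : tensor B B) (c c' : B) : (x, c) + (x', c') = (x + x', c + c').
  by [].
have pairE (x x' : tensor B B) (c c' : B) : x = x' -> c = c' -> (x, c) = (x', c').
  by move=> -> ->.
case=> {u} [r s|u v|w|x y z].
- move: r; apply: kill_from_gmon => [r r'|r]; cbv beta.
    rewrite pairD tensDl tensDr mulrDl barD !opprD.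
    by apply: pairE; exact: addrACA.
  move: s; apply: kill_from_gmon => [s s'|s]; cbv beta.
    rewrite pairD tensDl tensDr mulrDr barD !opprD.
    by apply: pairE; exact: addrACA.
  rewrite -gmonM bar_gmon !oppr_grpring raddf_pair raddf_pairl raddf_pairr Fsym.
  exact: V2.
- move: u; apply: kill_from_gmon => [u u'|u]; cbv beta.
    rewrite pairD barD !tensDl mulrDl mulrDr opprD.
    by apply: pairE; exact: addrACA.
  move: v; apply: kill_from_gmon => [v v'|v]; cbv beta.
    rewrite pairD barD !tensDr mulrDl mulrDr opprD.
    by apply: pairE; exact: addrACA.
  rewrite -!gmonM !bar_gmon !oppr_grpring raddf_pair raddf_pairl raddf_pairr Fbar.
  exact: V2.
- by rewrite mulr2n grpring_exponent2 raddf0.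
move: x; apply: kill_from_gmon => [x x'|x]; cbv beta.
  rewrite pairD mulrDl mulrDr; apply: pairE; last by rewrite addr0.
  by apply: hochD; exact: tensDl.
move: y; apply: kill_from_gmon => [y y'|y]; cbv beta.
  rewrite pairD mulrDr mulrDl; apply: pairE; last by rewrite addr0.
  by apply: hochD; [exact: tensDl | exact: tensDr | exact: tensDr].
move: z; apply: kill_from_gmon => [z z'|z]; cbv beta.
  rewrite pairD mulrDr mulrDl; apply: pairE; last by rewrite addr0.
  by apply: hochD; [exact: tensDr | exact: tensDr | exact: tensDl].
by rewrite -!gmonM oppr_tensor addrAC !raddf_pairl Fhoch V2.
Qed.

End Relators.

(** * The twisted action *)

Section TwistedAction.
Variable G : groupType.
Local Notation GG := (G * 'Z_4)%type.
Local Open Scope group_scope.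

Definition act (w : G) (a : GG) : G :=
  if odd a.2 then (w ^ a.1)^-1 else w ^ a.1.

Definition c4 (n : nat) : 'Z_4 := inZp n.

Lemma c4E (k : 'Z_4) : [\/ k = c4 0, k = c4 1, k = c4 2 | k = c4 3].
Proof.
by case: k => [[|[|[|[|//]]]] ?]; [constructor 1|constructor 2|constructor 3|
  constructor 4]; apply: val_inj.
Qed.

Lemma c4M m n : c4 m * c4 n = c4 (m + n).
Proof. by apply: val_inj; rewrite /= modnDm. Qed.

Lemma odd_c4M (k l : 'Z_4) : odd (k * l)%g = odd k (+) odd l.
Proof.
have -> : nat_of_ord (k * l)%g = ((k + l) %% 4)%N by [].
by rewrite odd_mod ?oddD.
Qed.

Lemma mulGG (g h : G) (k l : 'Z_4) : (g, k) * (h, l) = (g * h, k * l) :> GG.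
Proof. by []. Qed.

(** Conjugation commutes with inversion, and only the parity of the second component matters. *)
Lemma actM w a b : act w (a * b) = act (act w a) b.
Proof.
rewrite /act /= odd_c4M conjgM; case: (odd a.2); case: (odd b.2) => //=.
- by rewrite conjVg invgK.
- by rewrite conjVg.
Qed.

Lemma act1 w : act w 1 = w.
Proof. by rewrite /act /= conjg1. Qed.

Lemma actK w a : act (act w a) a^-1 = w.
Proof. by rewrite -actM mulgV act1. Qed.

Lemma act0 w g : act w (g, c4 0) = w ^ g.
Proof. by []. Qed.

Lemma act_flip w : act w (1, c4 1) = w^-1.
Proof. by rewrite /act /= conjg1. Qed.

Lemma act_half w : act w (1, c4 2) = w.
Proof. by rewrite /act /= conjg1. Qed.

(** For [w = r * s], the composite label of the arrows [r] and [s] around the loop at [w], followed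
    by the two flips from [w] to its inverse and back. *)
Definition twist (w : G) : GG := (w, c4 2).

Lemma act_twist w : act w (twist w) = w.
Proof. by rewrite /act /= conjgE mulKg. Qed.

(** The inverse arises when [a] has odd second component. A homomorphism to a group of exponent 2
    does not see it, so killing the twist at one point of an orbit kills it at all points. *)
Lemma twistJ w a : a * twist (act w a) * a^-1 = twist w \/
  a * twist (act w a) * a^-1 = (twist w)^-1.
Proof.
have V4 (k : 'Z_4) : k * c4 2 * k^-1 = c4 2.
  by case: (c4E k) => ->; apply: val_inj.
have V2 : (c4 2)^-1 = c4 2 by apply: val_inj.
case: a => g k; rewrite /act /twist /=; case: (odd k) => /=.
  right; congr (_, _) => /=; last by rewrite V4 V2.
  by rewrite conjgE !invgM !invgK !mulgA mulgV mul1g mulgK.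
left; congr (_, _) => /=; last exact: V4.
by rewrite conjgE !mulgA mulgV mul1g mulgK.
Qed.

End TwistedAction.

(** * Stabilizers through their universal property *)

Section Presentation.
Variable G : groupType.
Local Notation GG := (G * 'Z_4)%type.

(** [chi] is a function on all of [GG], so that stabilizers need not be made into types; only its
    values on the stabilizer of [z] are constrained. *)
Definition stab_char (V : zmodType) (z : G) (chi : GG -> V) : Prop :=
  (forall a b, act z a = z -> act z b = z -> chi (a * b)%g = chi a + chi b) /\
  chi (twist z) = 0.

(* V is the direct sum over i of the mod 2 abelianized stabilizers of z i modulo
   twist (z i), stated through its universal property; the values of l i and
   chi i outside the stabilizer are junk. *)
Record presents (I : Type) (z : I -> G) (V : zmodType) (l : I -> GG -> V) : Prop :=
  Presents {
    presents_char : forall i, stab_char (z i) (l i);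
    presents_exponent2 : exponent2 V;
    presents_lift : forall W : zmodType, exponent2 W ->
      forall chi : I -> GG -> W, (forall i, stab_char (z i) (chi i)) ->
      exists F : {additive V -> W},
        forall i a, act (z i) a = z i -> F (l i a) = chi i a;
    presents_gen : forall P : V -> Prop, subgroup_pred P ->
      (forall i a, act (z i) a = z i -> P (l i a)) -> forall v, P v }.

End Presentation.

(** * Arrows and paths *)

Section ArrowCocycle.
Variables (G : groupType) (V : zmodType) (V2 : exponent2 V).
Local Notation GG := (G * 'Z_4)%type.
(* A g h stands for the image of g (x) h and f w for that of w in the second
   summand, so flips w k is the image of k successive arrows labelled (1, 1)
   starting at w. *)
Variables (A : G -> G -> V) (f : G -> V).

Hypothesis Asym : forall r s, A r s + A s r = f (r * s)%g + f (r * s)^-1%g.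
Hypothesis Abar : forall u v,
  A u v + A u^-1%g v^-1%g = f (v * u)%g + f (u * v)%g.
Hypothesis Ahoch : forall x y z, A (x * y)%g z + A (z * x)%g y = A x (y * z)%g.

(** The tensor [x (x) g] has source [g * x]; source [w] forces [x = g^-1 * w]. *)
Definition arrow (w g : G) : V := A (g^-1 * w)%g g.

(** The sources alternate between [w] and its inverse. For [k = 3] the first and third flips both
    start at [w] and cancel. *)
Definition flips (w : G) (k : 'Z_4) : V :=
  f w *+ ((k == c4 1) || (k == c4 2)) + f w^-1%g *+ ((k == c4 2) || (k == c4 3)).

Definition path_value (w : G) (a : GG) : V := arrow w a.1 + flips (w ^ a.1)%g a.2.

Let addVV (u v : V) : u + (u + v) = v.
Proof. by rewrite addrA V2 add0r. Qed.

Lemma arrowM w g h : arrow w (g * h)%g = arrow w g + arrow (w ^ g)%g h.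
Proof.
have := Ahoch (h^-1 * g^-1 * w)%g g h.
by rewrite /arrow invgM conjgE !mulgA mulgV mul1g addrC => ->.
Qed.

Lemma arrow1 w : arrow w 1%g = 0.
Proof.
by apply: (addrI (arrow w 1%g)); rewrite -{2}(conjg1 w) -arrowM mulg1 addr0.
Qed.

Lemma arrowV w g : arrow (w ^ g)%g g^-1%g = arrow w g.
Proof. by apply/esym/(exponent2_eq V2); rewrite -arrowM mulgV arrow1. Qed.

(** [Abar] at [u = g^-1 * w] and [v = g]: a commuting square whose sides are the arrows labelled [g]
    at [w] and at [w^-1] and the flips at their ends. *)
Lemma arrow_inv w g : arrow w^-1%g g = arrow w g + f w + f (w ^ g)%g.
Proof.
have := Abar (g^-1 * w)%g g.
have -> : (g^-1 * w * g = w ^ g)%g by rewrite conjgE mulgA.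
have -> : A (g^-1 * w)^-1%g g^-1%g = arrow (w^-1 ^ g)%g g^-1%g.
  by rewrite /arrow conjgE !invgM !invgK !mulgA mulgV mul1g.
by rewrite arrowV mulVKg -addrA => <-; rewrite addVV.
Qed.

(** [Asym] at [r = 1], where [A w 1] is an arrow labelled by the identity and vanishes. *)
Lemma arrow_self w : arrow w w = f w + f w^-1%g.
Proof.
have := Asym 1%g w; rewrite mul1g => <-.
have := arrow1 w; rewrite /arrow invg1 mul1g => ->.
by rewrite mulVg addr0.
Qed.

Lemma flips_conj w g k :
  arrow w g + flips (w ^ g)%g k = flips w k + arrow (act w (1%g, k)) g.
Proof.
rewrite /flips /act /= conjg1 -conjVg.
(* Applying [arrow_inv] at [w^-1] and then at [w] returns to the same arrow, so the four flips
   involved sum to zero. *)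
have fV : f (w^-1 ^ g)%g = f w + (f (w ^ g)%g + f w^-1%g).
  have := arrow_inv w^-1%g g; rewrite invgK arrow_inv -!addrA => E.
  apply/esym/(exponent2_eq V2)/(addrI (arrow w g)).
  by rewrite addr0 -!addrA; exact: esym E.
have wE := arrow_inv w g.
case: (c4E k) => -> /=; rewrite ?mulr0n ?mulr1n ?addr0 ?add0r ?wE ?fV.
- by [].
- by rewrite -!addrA [RHS]addrCA addVV.
- rewrite [f (w ^ g)%g + (_ + _)]addrCA addVV; exact: addrC.
- by rewrite -!addrA [RHS]addrCA [f w^-1%g + _]addrC -addrA.
Qed.

Lemma flipsM w k l :
  flips w (k * l)%g = flips w k + flips (act w (1%g, k)) l.
Proof.
rewrite /flips /act /= conjg1.
by case: (c4E k) => ->; case: (c4E l) => ->;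
  rewrite c4M /= ?invgK ?mulr0n ?mulr1n ?addr0 ?add0r ?[_ + f w]addrC ?addVV ?V2 //
    ?[f w^-1%g + _]addrC -?addrA ?V2 ?addr0.
Qed.

(** A label [(g, k)] means conjugation by [g], then [k] flips. To compose two of them, [flips_conj]
    slides the flips of [a] past the conjugation of [b]. *)
Lemma path_valueM w a b :
  path_value w (a * b)%g = path_value w a + path_value (act w a) b.
Proof.
case: a b => [g k] [h l]; rewrite /path_value mulGG /= arrowM conjgM flipsM.
have -> : act w (g, k) = act (w ^ g)%g (1%g, k) by rewrite /act /= conjg1.
have -> : act ((w ^ g) ^ h)%g (1%g, k) = (act (w ^ g) (1%g, k) ^ h)%g.
  by rewrite /act /= !conjg1; case: ifP; rewrite // conjVg.
rewrite -[LHS]addrA -[RHS]addrA; congr (_ + _).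
by rewrite [LHS]addrA [RHS]addrA flips_conj.
Qed.

(** By [arrow_self] the arrow labelled [w] equals the two flips that follow it. *)
Lemma path_value_twist w : path_value w (twist w) = 0.
Proof.
rewrite /path_value /= arrow_self conjgE mulKg /flips /= !mulr1n.
exact: V2.
Qed.

End ArrowCocycle.

Lemma path_value_raddf (G : groupType) (U V : zmodType) (F : {additive U -> V})
    (A : G -> G -> U) (f : G -> U) w a :
  F (path_value A f w a) =
  path_value (fun g h => F (A g h)) (fun g => F (f g)) w a.
Proof. by rewrite /path_value /arrow /flips !raddfD /= !raddfMn. Qed.

Lemma eq_path_value (G : groupType) (V : zmodType) (A A' : G -> G -> V)
    (f f' : G -> V) w a :
  A =2 A' -> f =1 f' -> path_value A f w a = path_value A' f' w a.
Proof. by move=> eqA eqf; rewrite /path_value /arrow /flips eqA !eqf. Qed.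

Section KillRelators.
Variables (G : groupType) (V : zmodType) (V2 : exponent2 V).
Local Notation B := (grpring 'F_2 G).
Local Notation chains := (tensor B B * B)%type.
Variable F : {additive chains -> V}.
Hypothesis F_rel : forall u, hq1_rel u -> F u = 0.

Let A (g h : G) : V := F (tens (gmon g) (gmon h), 0).
Let f (g : G) : V := F (0, gmon g).

(** With [kill_bar] and [kill_hoch], a converse to [hq1_rel_kill]: killing the relators gives the
    identities on group elements, and with them the path calculus. *)
Lemma kill_sym r s : A r s + A s r = f (r * s)%g + f (r * s)^-1%g.
Proof.
apply: (exponent2_eq V2).
have := F_rel (HQ1RelSym (gmon r) (gmon s)).
by rewrite -gmonM bar_gmon !oppr_grpring raddf_pair raddf_pairl raddf_pairr.
Qed.

Lemma kill_bar u v : A u v + A u^-1%g v^-1%g = f (v * u)%g + f (u * v)%g.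
Proof.
apply: (exponent2_eq V2).
have := F_rel (HQ1RelBar (gmon u) (gmon v)).
by rewrite -!gmonM !bar_gmon !oppr_grpring raddf_pair raddf_pairl raddf_pairr.
Qed.

Lemma kill_hoch x y z : A (x * y)%g z + A (z * x)%g y = A x (y * z)%g.
Proof.
apply: (exponent2_eq V2).
have := F_rel (HQ1RelHoch (gmon x) (gmon y) (gmon z)).
have AC (a b c : V) : a + b + c = 0 -> a + c + b = 0 by rewrite addrAC.
by rewrite -!gmonM oppr_tensor !raddf_pairl => /AC.
Qed.

Lemma kill_pathM w a b :
  path_value A f w (a * b)%g = path_value A f w a + path_value A f (act w a) b.
Proof. exact: (path_valueM V2 kill_bar kill_hoch). Qed.

Lemma kill_path_twist w : path_value A f w (twist w) = 0.
Proof. exact: (path_value_twist V2 kill_sym kill_hoch). Qed.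

End KillRelators.

(** * Transport of arrows to loops at base points *)

Section Transport.
Variables (G : groupType) (I : Type) (z : I -> G) (V : zmodType).
Local Notation GG := (G * 'Z_4)%type.
Variables (l : I -> GG -> V) (base : G -> I) (p : G -> GG).
Hypotheses (V2 : exponent2 V) (lP : forall i, stab_char (z i) (l i)).
Hypothesis base_act : forall w a, base (act w a) = base w.
Hypothesis act_p : forall w, act (z (base w)) (p w) = w.
Hypothesis base_z : forall i, base (z i) = i.

(** [p w] leads from the base point to [w], so this goes out to [w], along [a], and back to the base
    point. *)
Definition loop (w : G) (a : GG) : GG := (p w * a * (p (act w a))^-1)%g.

Definition transport (w : G) (a : GG) : V := l (base w) (loop w a).

Let l1 i : l i 1%g = 0.
Proof.
by apply: (addrI (l i 1%g)); rewrite -(lP i).1 ?act1 // mul1g addr0.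
Qed.

Let lV i a : act (z i) a = z i -> l i a^-1%g = l i a.
Proof.
move=> za; apply: (exponent2_eq V2); rewrite -(lP i).1 ?mulVg ?l1 //.
by rewrite -{1}za actK.
Qed.

Lemma act_loop w a : act (z (base w)) (loop w a) = z (base w).
Proof.
by rewrite /loop !actM act_p -(base_act w a) -{1}(act_p (act w a)) actK.
Qed.

(** The return path of the first loop cancels the outward path of the second. *)
Lemma transportM w a b :
  transport w (a * b)%g = transport w a + transport (act w a) b.
Proof.
rewrite /transport base_act -(lP _).1 ?act_loop //; last first.
  by rewrite -[in LHS](base_act w a) act_loop base_act.
by rewrite /loop actM !mulgA mulgVK.
Qed.

Lemma transport1 w : transport w 1%g = 0.
Proof.
apply: (addrI (transport w 1%g)).
by rewrite -{2}(act1 w) -transportM mulg1 addr0.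
Qed.

Lemma transport_twist w : transport w (twist w) = 0.
Proof.
rewrite /transport /loop act_twist; have [_ lt] := lP (base w).
have := twistJ (z (base w)) (p w); rewrite act_p.
by case=> ->; rewrite ?lV // act_twist.
Qed.

(** [p (z i)] need not be trivial, but it is a loop at [z i], and its two occurrences cancel in
    exponent 2. *)
Lemma transport_base i a : act (z i) a = z i -> transport (z i) a = l i a.
Proof.
move=> za; rewrite /transport /loop za base_z.
have zp : act (z i) (p (z i)) = z i by rewrite -{1}(base_z i) act_p.
have zpV : act (z i) (p (z i))^-1%g = z i by rewrite -{1}zp actK.
rewrite !(lP i).1 ?actM ?zp // lV // addrC addrA V2 add0r //.
Qed.

Let A (g h : G) : V := transport (h * g)%g (h, c4 0).
Let f (g : G) : V := transport g (1%g, c4 1).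

(** The two sides together are the transport of [twist (r * s)], which is zero. *)
Lemma transport_sym r s : A r s + A s r = f (r * s)%g + f (r * s)^-1%g.
Proof.
have actr : act (r * s)%g (r, c4 0) = (s * r)%g.
  by rewrite act0 conjgE mulgA mulKg.
rewrite /f -act_flip -transportM addrC /A -actr -transportM !mulGG !c4M mulg1.
apply: (exponent2_eq V2); rewrite -[RHS](transport_twist (r * s)%g).
have -> : twist (r * s)%g = (((r * s)%g, c4 0) * (1%g, c4 2))%g :> GG.
  by rewrite mulGG mulg1 c4M.
by rewrite transportM act0 conjgE mulKg.
Qed.

Lemma transport_bar u v : A u v + A u^-1%g v^-1%g = f (v * u)%g + f (u * v)%g.
Proof.
have actv : act (v * u)%g (v, c4 0) = (u * v)%g.
  by rewrite act0 conjgE mulgA mulKg.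
(* The flip at [v * u] is conjugation by [v], then the flip at [u * v], then conjugation by
   [v^-1]. *)
have E : transport (v * u)%g (1%g, c4 1) = A u v + f (u * v)%g + A u^-1%g v^-1%g.
  rewrite /A /f -actv -transportM.
  have -> : (v^-1 * u^-1)%g = act (v * u)%g ((v, c4 0) * (1%g, c4 1))%g.
    by rewrite actM actv act_flip invgM.
  by rewrite -transportM !mulGG mulg1 mulgV !c4M.
have AC (a b c : V) : a + b = a + c + b + c.
  by rewrite [RHS]addrAC -[a + c + c]addrA V2 addr0.
by rewrite [f (v * u)%g]E; exact: AC.
Qed.

Lemma transport_hoch x y z' :
  A (x * y)%g z' + A (z' * x)%g y = A x (y * z')%g.
Proof.
rewrite /A addrC.
have -> : (z' * (x * y))%g = act (y * (z' * x))%g (y, c4 0).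
  by rewrite act0 conjgE !mulgA mulVg mul1g.
by rewrite -transportM mulGG c4M !mulgA.
Qed.

(** [transport] is additive along composition, so its values on single arrows determine it. *)
Lemma path_transport w a : path_value A f w a = transport w a.
Proof.
case: a => g k; rewrite /path_value /= /arrow /A mulVKg.
have -> : (g, k) = ((g, c4 0) * (1%g, k))%g :> GG.
  by rewrite mulGG mulg1; congr (_, _); apply: val_inj; rewrite /= add0n modZp.
rewrite transportM act0; congr (_ + _); move: (w ^ g)%g => {}w.
have flipn w' n :
    transport w' (1%g, c4 n.+1) = f w' + transport w'^-1%g (1%g, c4 n).
  by rewrite -act_flip -transportM mulGG mulg1 c4M add1n.
have flip0 w' : transport w' (1%g, c4 0) = 0.
  by rewrite -(transport1 w'); congr (transport _ (_, _)); apply: val_inj.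
rewrite /flips; case: (c4E k) => -> /=; rewrite ?flipn flip0 ?invgK.
- by rewrite addr0.
- by rewrite mulr1n.
- by rewrite addr0 !mulr1n.
- by rewrite mulr1n add0r addr0 addrCA V2 addr0.
Qed.

End Transport.

(** * Reduction to presented stabilizers *)

Section Reduction.
Variable G : groupType.
Local Notation GG := (G * 'Z_4)%type.
Local Notation B := (grpring 'F_2 G).
Local Notation chains := (tensor B B * B)%type.

Let tA (g h : G) : chains := (tens (gmon g) (gmon h), 0).
Let tf (g : G) : chains := (0, gmon g).

Definition hq1_boundary (u : chains) : B := hqb u.1 + u.2 - bar u.2.

Lemma hq1_boundaryB : zmod_morphism hq1_boundary.
Proof.
have AC (a a' b b' c c' : B) :
    a - a' + (b - b') - (c - c') = (a + b - c) - (a' + b' - c').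
  by rewrite !opprD !opprK [RHS]addrACA; congr (_ + _); exact: addrACA.
by move=> u v; rewrite /hq1_boundary raddfB barB; exact: AC.
Qed.

HB.instance Definition _ :=
  GRing.isZmodMorphism.Build chains B hq1_boundary hq1_boundaryB.

Lemma boundary_tens g h : hq1_boundary (tA g h) = gmon (g * h)%g + gmon (h * g)%g.
Proof.
rewrite /hq1_boundary /= hqbE bar0 subr0 addr0 !gmonM.
by rewrite oppr_grpring.
Qed.

Lemma boundary_flip g : hq1_boundary (tf g) = gmon g + gmon g^-1%g.
Proof.
rewrite /hq1_boundary /= raddf0 add0r bar_gmon.
by rewrite oppr_grpring.
Qed.

Lemma boundary_path w a :
  hq1_boundary (path_value tA tf w a) = gmon w + gmon (act w a).
Proof.
case: a => g k; rewrite path_value_raddf /path_value /arrow /flips /=.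
rewrite boundary_tens !boundary_flip mulVKg invgK.
have -> : (g^-1 * w * g = w ^ g)%g by rewrite conjgE mulgA.
rewrite [gmon (w ^ g)%g + gmon w]addrC -addrA; congr (_ + _); rewrite /act /=.
move: (w ^ g)%g => x.
have addxx (u v : B) : u + (u + v) = v by rewrite addrA grpring_exponent2 add0r.
case: (c4E k) => -> /=; rewrite ?mulr0n ?mulr1n ?addr0 ?add0r ?addxx //.
- by rewrite [gmon x^-1%g + _]addrC grpring_exponent2 addr0.
- by rewrite [gmon x^-1%g + _]addrC addxx.
Qed.

(** Every basis chain is a path value or a difference of two. *)
Lemma chains_path_ind (P : chains -> Prop) : subgroup_pred P ->
  (forall w a, P (path_value tA tf w a)) -> forall u, P u.
Proof.
move=> PS Pp.
have Pt g h : P (tA g h).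
  have := Pp (h * g)%g (h, c4 0); rewrite /path_value /flips /=.
  by rewrite !mulr0n !addr0 /arrow mulKg.
apply: (chains_ind PS) => // g.
have := Pp g (1%g, c4 1); rewrite /path_value /flips /= mulr0n mulr1n addr0.
rewrite conjg1 /arrow invg1 mul1g => Pg.
(* Before the relators are imposed, the arrow labelled by the identity need not vanish, so it is
   subtracted. *)
have -> : (0, gmon g) = tA g 1%g + tf g - tA g 1%g by rewrite addrAC subrr add0r.
by case: PS => _; apply.
Qed.

(** All chains modulo the relators, so that single arrows have classes too. *)
Let Q : zmodType := zquot (@hq1_rel B).

Let Q2 : exponent2 Q.
Proof.
apply: zquot_ind => u; rewrite -raddfD /=.
by rewrite (@chains_exponent2 G u) raddf0.
Qed.

(** Relators are cycles, so their span in all chains already lies in the cycles; hence [HQ1] embeds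
    in [Q]. *)
Lemma zspan_hq1_cycles u : zspan_spec (@hq1_rel B) u ->
  exists2 c : hq1_cycles B, val c = u &
    zspan_spec [set v : hq1_cycles B | hq1_rel (val v)] c.
Proof.
elim=> {u} [u ru||u v _ [c <- sc] _ [d <- sd]].
- by exists (HQ1Cycle (hq1_rel_cycle ru)) => //; exact: ZspanIn.
- by exists 0; [rewrite raddf0 | exact: Zspan0].
- by exists (c - d); [rewrite raddfB | exact: ZspanB].
Qed.

Variables (I : Type) (z : I -> G) (V : zmodType) (l : I -> GG -> V).
Hypothesis lP : presents z l.
Hypothesis z_orbit : forall w, exists i a, act (z i) a = w.
Hypothesis z_inj : forall i j a, act (z i) a = z j -> i = j.

(** The map is induced by transport to base points. Its inverse direction, on all chains modulo
    relators, comes from the universal property of [V]; the two compose to the identity on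
    cycles. *)
Theorem hq1_bijection : exists f : {additive HQ1 B -> V}, bijective f.
Proof.
have [l_char V2 l_lift l_gen] := lP.
(* Choose for every [w] the base point of its orbit and a path from there. *)
have [base /choice [p act_p]] := choice z_orbit.
have base_act w a : base (act w a) = base w.
  apply: (z_inj (a := p (act w a) * a^-1 * (p w)^-1)%g).
  by rewrite !actM act_p actK -{1}(act_p w) actK.
have base_z i : base (z i) = i by exact: (z_inj (act_p (z i))).
pose L := transport l base p.
have [Phi [Phi_tens Phi_flip]] := chains_lift
  (fun g h => L (h * g)%g (h, c4 0)) (fun g => L g (1%g, c4 1)) V2.
have Phi_rel u : hq1_rel u -> Phi u = 0.
  have add_eq (a b c d a' b' c' d' : V) : a = a' -> b = b' -> c = c' -> d = d' ->
    a' + b' = c' + d' -> a + b = c + d by move=> -> -> -> ->.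
  apply: (hq1_rel_kill V2) => [r s|x y|x y t].
  - apply: (add_eq _ _ _ _ _ _ _ _ (Phi_tens _ _) (Phi_tens _ _) (Phi_flip _)
      (Phi_flip _)); exact: (transport_sym V2 l_char base_act act_p).
  - apply: (add_eq _ _ _ _ _ _ _ _ (Phi_tens _ _) (Phi_tens _ _) (Phi_flip _)
      (Phi_flip _)); exact: (transport_bar V2 l_char base_act act_p).
  - apply: etrans (congr2 +%R (Phi_tens _ _) (Phi_tens _ _)) _.
    apply: etrans _ (esym (Phi_tens _ _)).
    exact: (transport_hoch l_char base_act act_p).
have Phi_path w a : Phi (path_value tA tf w a) = L w a.
  rewrite path_value_raddf /L -(path_transport V2 l_char base_act act_p).
  exact: eq_path_value.
pose kappa : {additive chains -> Q} := zclass (@hq1_rel B).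
pose lam := path_value (fun g h => kappa (tA g h)) (fun g => kappa (tf g)).
have lamM := kill_pathM Q2 (@zclass_in _ (@hq1_rel B)) : forall w a b,
  lam w (a * b)%g = lam w a + lam (act w a) b.
have lam_twist := kill_path_twist Q2 (@zclass_in _ (@hq1_rel B)) : forall w,
  lam w (twist w) = 0.
(* On each stabilizer the universal path value [lam] is a character killing the twist, so it factors
   through [V]. *)
have [] := l_lift Q Q2 (fun i => lam (z i)).
  by move=> i; split=> // a b za _; rewrite lamM za.
move=> F F_l.
have lamV w a : lam (act w a) a^-1%g = lam w a.
  have lam1 : lam w 1%g = 0.
    by apply: (addrI (lam w 1%g)); rewrite -{2}(act1 w) -lamM mulg1 addr0.
  by apply/esym/(exponent2_eq Q2); rewrite -lamM mulgV lam1.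
pose P w := lam (z (base w)) (p w).
have lamP w : lam w (p w)^-1%g = P w by rewrite -{1}(act_p w) lamV.
have F_L w a : F (L w a) = lam w a + (P w + P (act w a)).
  rewrite /L /transport F_l; last exact: (act_loop base_act act_p).
  rewrite /loop !lamM actM act_p lamP.
  by rewrite [_ + lam w a]addrC -addrA.
pose Pext : {additive B -> Q} :=
  HB.pack (gext P) (GRing.isZmodMorphism.Build _ _ _ (gext_zmod Q2 P)).
(* F \o Phi replaces an arrow by its conjugate by the paths to the base points,
   which changes a chain by a term depending only on its boundary. *)
have F_Phi u : F (Phi u) = kappa u + Pext (hq1_boundary u).
  have AC (a b c d : Q) : a + c - (b + d) = a - b + (c - d).
    by rewrite opprD; exact: addrACA.
  elim/chains_path_ind: u => [|w a].
    split=> [|u v Eu Ev]; first by rewrite !raddf0 addr0.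
    rewrite (raddfB Phi) (raddfB F) Eu Ev (raddfB kappa) hq1_boundaryB.
    by rewrite (raddfB Pext (hq1_boundary u) (hq1_boundary v)); exact: AC.
  rewrite Phi_path F_L path_value_raddf boundary_path raddfD.
  by rewrite [Pext (gmon w)]gext_gmon [Pext (gmon _)]gext_gmon.
have [f fE] : exists f : {additive HQ1 B -> V},
    forall c, f (zclass [set u : hq1_cycles B | hq1_rel (val u)] c) = Phi (val c).
  exact: (zquot_lift (f := Phi \o val) (fun u => Phi_rel (val u))).
(* On a cycle the boundary term of [F_Phi] vanishes, so [Phi] determines the class in [Q]. *)
have f_inj : injective f.
  apply: raddf_inj => x; elim/zquot_ind: x => c; rewrite fE /= => Phi0.
  have := F_Phi (val c); rewrite Phi0 raddf0.
  have -> : hq1_boundary (val c) = 0 by apply/eqP; exact: (valP c).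
  rewrite raddf0 addr0 -(raddf0 kappa) => /esym/zclass_eq; rewrite subr0.
  case/zspan_hq1_cycles => d /val_inj-> sc.
  rewrite -(raddf0 (zclass _ : {additive hq1_cycles B -> HQ1 B})).
  by apply/zclass_eq; rewrite subr0.
(* [V] is generated by the [l i a] with [a] a loop at [z i]; the chain of such a loop is a cycle. *)
have f_surj v : exists x, f x = v.
  elim/l_gen: v => [|i a za].
    split=> [|u v [x <-] [y <-]]; first by exists 0; rewrite raddf0.
    by exists (x - y); rewrite raddfB.
  have cyc : path_value tA tf (z i) a \in @hq1_cycle B.
    apply/eqP; change (hq1_boundary (path_value tA tf (z i) a) = 0).
    by rewrite boundary_path za grpring_exponent2.
  exists (zclass _ (HQ1Cycle cyc)); rewrite fE /= Phi_path.
  exact: (transport_base V2 l_char act_p base_z).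
have [g gK] := choice f_surj.
by exists f; apply: (Bijective _ gK) => x; apply: f_inj; exact: gK.
Qed.

End Reduction.

(** * The summands *)

Section SharpLift.
Variables (J : groupType) (W : zmodType) (W2 : exponent2 W) (chi : J -> W).
Hypothesis chiM : forall x y, chi (x * y)%g = chi x + chi y.

Let chi1 : chi 1%g = 0.
Proof. by apply: (addrI (chi 1%g)); rewrite -chiM mul1g addr0. Qed.

Let chiV x : chi x^-1%g = chi x.
Proof. by apply: (exponent2_eq W2); rewrite -chiM mulVg chi1. Qed.

Lemma chi_commutator_subgroup x : commutator_subgroup x -> chi x = 0.
Proof.
elim=> {x} [x y||x y _ x0 _ y0|x _ x0].
- rewrite commgEl conjgE !chiM !chiV [chi y + _]addrA [chi y + _]addrC.
  by rewrite -[chi x + chi y + chi y]addrA W2 addr0 W2.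
- exact: chi1.
- by rewrite chiM x0 y0 addr0.
- by rewrite chiV.
Qed.

Lemma chi_abel x y : abel x = abel y -> chi x = chi y.
Proof.
move/abel_eq/chi_commutator_subgroup; rewrite chiM chiV.
exact: exponent2_eq.
Qed.

Lemma sharp_lift :
  exists F : {additive sharp J -> W}, forall x, F (to_sharp x) = chi x.
Proof.
pose h (u : abelz J) := chi (repr u).
have h_abel x : h (abel x) = chi x by apply: chi_abel; exact: abel_repr.
have hD u v : h (u + v) = h u + h v.
  by rewrite -[u]abel_repr -[v]abel_repr -abelMD !h_abel chiM.
have hB : zmod_morphism h.
  by move=> u v; apply: (addIr (h v)); rewrite -hD !subrK.
pose ha : {additive abelz J -> W} :=
  HB.pack h (GRing.isZmodMorphism.Build _ _ _ hB).
have [|F FE] := @zquot_lift (abelz J) W (sharp_rel (J := J)) ha.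
  by move=> _ [u _ <-]; rewrite raddfD W2.
by exists F => x; rewrite FE /ha /= h_abel.
Qed.

End SharpLift.

Section Sharp.
Variable J : groupType.

Lemma to_sharpM (x y : J) : to_sharp (x * y)%g = to_sharp x + to_sharp y.
Proof. by rewrite /to_sharp abelMD raddfD. Qed.

Lemma to_sharp_surj (u : sharp J) : exists x, u = to_sharp x.
Proof. by exists (repr (repr u)); rewrite /to_sharp abel_repr zclass_repr. Qed.

Lemma sharp_exponent2 : exponent2 (sharp J).
Proof.
move=> u; have [x ->] := to_sharp_surj u; rewrite /to_sharp -raddfD.
by apply: zclass_in; exists (abel x).
Qed.

Lemma sharp_quot_exponent2 (X : set (sharp J)) : exponent2 (zquot X).
Proof. by apply: zquot_ind => u; rewrite -raddfD sharp_exponent2 raddf0. Qed.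

End Sharp.

Definition presentable (G : groupType) (z : G) (V : zmodType) : Prop :=
  exists l, presents (fun _ : unit => z) (fun _ => l) (V := V).

Section Summands.
Variables (G : groupType) (z : G).
Local Notation GG := (G * 'Z_4)%type.

Lemma presentable_intro (V : zmodType) (l : GG -> V) :
  exponent2 V -> stab_char z l ->
  (forall W : zmodType, exponent2 W -> forall chi : GG -> W, stab_char z chi ->
    exists F : {additive V -> W}, forall a, act z a = z -> F (l a) = chi a) ->
  (forall v, exists2 a, act z a = z & v = l a) ->
  presentable z V.
Proof.
move=> V2 lP l_lift l_surj; exists l; split=> // [W W2 chi chiP|P PS Pl v].
  by have [F FE] := l_lift W W2 (chi tt) (chiP tt); exists F => -[].
by have [a za ->] := l_surj v; apply: (Pl tt).
Qed.

Lemma Z2_exponent2 : exponent2 'Z_2.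
Proof. by case=> [[|[|//]] ?]; apply: val_inj. Qed.

(** Since [z = z^-1], the stabilizer is G_z x C_4, and C_4 contributes C_2 modulo squares. As
    [(1, 2)] is the square of [(1, 1)], the twist [(z, 2)] amounts to [z]. *)
Lemma summand1_presentable : type1 z -> presentable z (summand1 z).
Proof.
move=> z1.
have in_Gz a : act z a = z -> exists e : Gz z, val e = a.1.
  move=> za; suff a_in : a.1 \in centralizer z.
    by exists (SubGrp (centralizer_closed z) a_in).
  rewrite unfold_in /centralizer; apply/eqP; move: za; rewrite /act.
  by case: ifP => //= _ zg; rewrite -[LHS]invgK zg -z1.
have stabE (e : Gz z) k : act z (val e, k) = z.
  by rewrite /act /= (eqP (valP e)) -z1 if_same.
pose l (a : GG) : summand1 z :=
  if insub a.1 is Some e then (zclass _ (to_sharp e), C4_to_C2 a.2) else 0.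
have lE (e : Gz z) k : l (val e, k) = (zclass _ (to_sharp e), C4_to_C2 k).
  by rewrite /l /= valK.
apply: (presentable_intro (l := l)).
- by case=> u c; congr (_, _); [exact: sharp_quot_exponent2 | exact: Z2_exponent2].
- split.
    case=> [g k] [h m] /in_Gz/= [e <-] /in_Gz/= [f <-].
    have -> : ((val e, k) * (val f, m))%g = (val (e * f)%g, (k * m)%g) :> GG by [].
    by rewrite !lE to_sharpM raddfD C4_to_C2M.
  have -> : twist z = (val (z_in_Gz z), c4 2) by [].
  by rewrite lE zclass_in //; congr (_, _); apply: val_inj.
- move=> W W2 chi [chiM chi_twist].
  have chi11 : chi (1%g, c4 2) = 0.
    have -> : (1%g, c4 2) = ((1%g, c4 1) * (1%g, c4 1))%g :> GG.
      by rewrite mulGG mulg1 c4M.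
    by rewrite chiM ?W2 // act_flip -z1.
  have [|F0 F0E] := @sharp_lift (Gz z) W W2 (fun e => chi (val e, c4 0)).
    move=> e f; rewrite -chiM ?stabE //.
    by rewrite mulGG c4M.
  have [|F1 F1E] := @zquot_lift _ _ [set to_sharp (z_in_Gz z)] F0.
    move=> _ ->; rewrite F0E -chi_twist.
    have -> : twist z = ((val (z_in_Gz z), c4 0) * (1%g, c4 2))%g :> GG.
      by rewrite mulGG c4M mulg1.
    by rewrite chiM ?chi11 ?addr0 ?stabE ?act_half.
  pose F (u : summand1 z) := F1 u.1 + chi (1%g, c4 1) *+ u.2.
  have F_zmod : zmod_morphism F.
    move=> u v; apply: (addIr (F v)); rewrite subrK /F addrACA -raddfD subrK.
    congr (_ + _); rewrite -(mulrn_F2D W2).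
    by congr (_ *+ nat_of_ord _); rewrite -[LHS]/((u - v).2 + v.2) subrK.
  pose Fa : {additive summand1 z -> W} :=
    HB.pack F (GRing.isZmodMorphism.Build _ _ _ F_zmod).
  exists Fa.
  case=> g k /in_Gz/= [e <-]; rewrite lE /Fa /= /F /= F1E F0E.
  have -> : (val e, k) = ((val e, c4 0) * (1%g, k))%g :> GG.
    rewrite mulGG mulg1; congr (_, _); apply: val_inj.
    by rewrite /= add0n modZp.
  have z1k m : act z (1%g, m) = z by rewrite -(val1 (Gz z)) stabE.
  rewrite chiM ?stabE //; congr (_ + _).
  have chi10 : chi (1%g, c4 0) = 0.
    apply: (addrI (chi (1%g, c4 0))); rewrite -chiM // addr0 mulGG mulg1.
    by rewrite c4M.
  have chi13 : chi (1%g, c4 3) = chi (1%g, c4 1).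
    rewrite -[RHS]add0r -chi11 -chiM // mulGG mulg1.
    by rewrite c4M.
  by case: (c4E k) => -> /=; rewrite ?mulr0n ?mulr1n ?chi10 ?chi11 ?chi13.
case=> u c; have [e eE] := to_sharp_surj (repr u).
exists (val e, c4 c) => //.
rewrite lE -eE zclass_repr; congr (_, _).
by case: c => [[|[|//]] ?]; apply: val_inj.
Qed.

(** No element inverts [z], so the stabilizer is G_z x {0, 2}. Killing the twist identifies [(1, 2)]
    with [(z, 0)], which leaves the mod 2 abelianization of G_z. *)
Lemma summand3_presentable : type3 z -> presentable z (summand3 z).
Proof.
move=> z3.
have in_Gz a : act z a = z -> exists2 e : Gz z, val e = a.1 & ~~ odd a.2.
  rewrite /act; case: ifP => [_ za|_ za].
    case: z3; apply/asboolP; exists a.1.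
    by rewrite -{1}za invgK.
  have a_in : a.1 \in centralizer z by apply/eqP.
  by exists (SubGrp (centralizer_closed z) a_in).
have stabE (e : Gz z) (k : 'Z_4) : ~~ odd k -> act z (val e, k) = z.
  by rewrite /act /= (eqP (valP e)) => /negPf->.
have even_c4 (k : 'Z_4) : ~~ odd k -> k = c4 0 \/ k = c4 2.
  by case: (c4E k) => -> // _; [left|right].
pose l (a : GG) : summand3 z :=
  if insub a.1 is Some e
  then to_sharp e + to_sharp (z_in_Gz z) *+ (a.2 == c4 2) else 0.
have lE (e : Gz z) k :
    l (val e, k) = to_sharp e + to_sharp (z_in_Gz z) *+ (k == c4 2).
  by rewrite /l /= valK.
have S2 := @sharp_exponent2 (Gz z).
apply: (presentable_intro (l := l)) => //.
- split.
    case=> [g k] [h m] /in_Gz/= [e <- ek] /in_Gz/= [f <- fm].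
    have -> : ((val e, k) * (val f, m))%g = (val (e * f)%g, (k * m)%g) :> GG by [].
    rewrite !lE to_sharpM [RHS]addrACA; congr (_ + _).
    case: (even_c4 k ek) => ->; case: (even_c4 m fm) => ->; rewrite c4M /=.
    + by rewrite addr0.
    + by rewrite add0r.
    + by rewrite addr0.
    + by rewrite S2.
  have -> : twist z = (val (z_in_Gz z), c4 2) by [].
  by rewrite lE S2.
- move=> W W2 chi [chiM chi_twist].
  have [|F FE] := @sharp_lift (Gz z) W W2 (fun e => chi (val e, c4 0)).
    move=> e f; rewrite -chiM ?stabE //.
    by rewrite mulGG c4M.
  exists F; case=> g k /in_Gz/= [e <- ek]; rewrite lE raddfD raddfMn !FE.
  case: (even_c4 k ek) => -> /=; first by rewrite addr0.
  rewrite mulr1n.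
  have -> : (val e, c4 2) = ((val e, c4 0) * (1%g, c4 2))%g :> GG.
    by rewrite mulGG mulg1 c4M.
  rewrite chiM ?stabE ?act_half //; congr (_ + _).
  apply: (exponent2_eq W2); rewrite -chi_twist -chiM ?act_half //; last first.
    by rewrite -[RHS](stabE (z_in_Gz z) (c4 0)).
  by rewrite mulGG mulg1 c4M.
move=> v; have [e ->] := to_sharp_surj v.
by exists (val e, c4 0); rewrite ?stabE // lE addr0.
Qed.

(** The stabilizer consists of the pairs [(g, k)] where [g] centralizes [z] for even [k] and inverts
    it for odd [k]. As [z] differs from its inverse, this is the fibre product, with [zt2] as the
    twist. *)
Lemma summand2_presentable : type2 z -> presentable z (summand2 z).
Proof.
move=> [_ z2].
(* The embedding of the fibre product in [GG]; its image is the stabilizer of [z]. *)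
pose co (e : eGzC4 z) : GG := (val (val e).1, (val e).2).
have stab_co e : act z (co e) = z.
  case: e => -[e k] /= ek; move/eqP: (ek); rewrite /eGz_sign /act /co /=.
  have /orP[/eqP ze|/eqP ze] := valP e; rewrite unfold_in /centralizer ze.
    rewrite eqxx => kE; suff /negPf -> : ~~ odd k by [].
    by move: kE; case: (c4E k) => -> // /(congr1 val).
  rewrite eq_sym; case: eqP => // _ kE; suff -> : odd k by rewrite invgK.
  by move: kE; case: (c4E k) => -> // /(congr1 val).
have in_co a : act z a = z -> exists e, co e = a.
  case: a => g k; rewrite /act /= => za.
  have g_in : g \in ext_centralizer z.
    rewrite unfold_in /ext_centralizer; move: za; case: ifP => _ za.
      by rewrite -[X in _ || (_ == X^-1)%g]za invgK eqxx orbT.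
    by rewrite za eqxx.
  pose g' : eGz z := SubGrp (ext_centralizer_closed z) g_in.
  have k_in : (g', k) \in @fibre_prod G z.
    rewrite unfold_in /fibre_prod /eGz_sign /= unfold_in /centralizer.
    move: za; case: ifP => ok za.
      have -> : (z ^ g == z)%g = false.
        by apply/eqP => zg; case: z2; rewrite -[RHS]/(z^-1)%g -{2}zg -{1}za.
      by move: ok; case: (c4E k) => -> // _; apply/eqP/val_inj.
    rewrite za eqxx.
    by move: ok; case: (c4E k) => -> // _; apply/eqP/val_inj.
  by exists (SubGrp (fibre_prod_closed z) k_in).
pose l (a : GG) : summand2 z :=
  if insub a.1 is Some g then
    if insub (g, a.2) is Some e then zclass _ (to_sharp e) else 0 else 0.
have lE e : l (co e) = zclass _ (to_sharp e).
  rewrite /l /co /= valK; have -> : ((val e).1, (val e).2) = val e by case: (val e).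
  by rewrite valK.
apply: (presentable_intro (l := l)).
- exact: sharp_quot_exponent2.
- split=> [a b /in_co[e <-] /in_co[f <-]|].
    have -> : (co e * co f)%g = co (e * f)%g by [].
    by rewrite !lE to_sharpM raddfD.
  have -> : twist z = co (zt2 z) by congr (_, _); apply: val_inj.
  by rewrite lE zclass_in.
- move=> W W2 chi [chiM chi_twist].
  have [|F0 F0E] := @sharp_lift (eGzC4 z) W W2 (fun e => chi (co e)).
    by move=> e f; rewrite -chiM ?stab_co.
  have [|F FE] := @zquot_lift _ _ [set to_sharp (zt2 z)] F0.
    move=> _ ->; rewrite F0E -chi_twist; congr (chi (_, _)); exact: val_inj.
  by exists F => a /in_co[e <-]; rewrite lE FE F0E.
elim/zquot_ind=> v; have [e ->] := to_sharp_surj v.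
by exists (co e); rewrite ?stab_co ?lE.
Qed.

End Summands.

(** * Direct sums *)

Section DirectSumLift.
Variables (I : choiceType) (A : I -> zmodType).

Definition dsum_coord (i : I) (x : dirsum A) : A i := val x i.

Lemma dsum_coordB i : zmod_morphism (dsum_coord i).
Proof. by []. Qed.

HB.instance Definition _ i :=
  GRing.isZmodMorphism.Build (dirsum A) (A i) (dsum_coord i) (dsum_coordB i).

Lemma dirsum_eq (x y : dirsum A) :
  (forall i, dsum_coord i x = dsum_coord i y) -> x = y.
Proof. by move=> xy; apply/val_inj/functional_extensionality_dep. Qed.

Lemma dsum_in_subproof (i : I) (a : A i) :
  (dfwith (fun j => 0 : A j) a : zprod A) \in finsupport (A := A).
Proof.
apply/asboolP; apply: sub_finite_set (finite_set1 i) => j /=.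
by have [<- //|ji] := eqVneq i j; rewrite dfwith_out // eqxx.
Qed.

Definition dsum_in (i : I) (a : A i) : dirsum A := DirSum (dsum_in_subproof a).

Lemma coord_in i (a : A i) : dsum_coord i (dsum_in a) = a.
Proof. exact: dfwith_in. Qed.

Lemma coord_in_out i j (a : A i) : i != j -> dsum_coord j (dsum_in a) = 0.
Proof. exact: dfwith_out. Qed.

Lemma dsum_inB i : zmod_morphism (@dsum_in i).
Proof.
move=> a b; apply: dirsum_eq => j; rewrite raddfB /=.
have [<-|ij] := eqVneq i j; first by rewrite !coord_in.
by rewrite !coord_in_out // subr0.
Qed.

HB.instance Definition _ i :=
  GRing.isZmodMorphism.Build (A i) (dirsum A) (@dsum_in i) (@dsum_inB i).

Definition dsum_supp (x : dirsum A) : {fset I} :=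
  fset_set [set i | dsum_coord i x != 0].

Lemma in_dsum_supp x i : (i \in dsum_supp x) = (dsum_coord i x != 0).
Proof.
rewrite in_fset_set; last by have /asboolP := valP x.
by apply/idP/idP => [/set_mem|/mem_set].
Qed.

Lemma dirsumE x : x = \sum_(i <- dsum_supp x) dsum_in (dsum_coord i x).
Proof.
apply: dirsum_eq => j; rewrite raddf_sum /=.
have [jx|] := boolP (j \in dsum_supp x).
  rewrite (big_fsetD1 j) //= coord_in big1_seq ?addr0 // => i /=.
  by rewrite !inE => /andP[ij _]; rewrite coord_in_out.
move=> jx; rewrite big1_seq; last first.
  by move=> i /= ix; rewrite coord_in_out //; apply: contraNneq jx => <-.
by apply/eqP; move: jx; rewrite in_dsum_supp negbK.
Qed.

Variables (W : zmodType) (F : forall i, {additive A i -> W}).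

Let sumF (x : dirsum A) := \sum_(i <- dsum_supp x) F i (dsum_coord i x).

Let sumFEw (d : {fset I}) x : (dsum_supp x `<=` d)%fset ->
  sumF x = \sum_(i <- d) F i (dsum_coord i x).
Proof.
move=> le_d; apply: big_fset_incl => // i _; rewrite in_dsum_supp negbK.
by move=> /eqP->; rewrite raddf0.
Qed.

Let sumF_zmod : zmod_morphism sumF.
Proof.
move=> x y; pose d := (dsum_supp x `|` dsum_supp y)%fset.
have le_d : (dsum_supp (x - y) `<=` d)%fset.
  apply/fsubsetP => i; rewrite !inE !in_dsum_supp raddfB /=.
  by apply: contraNT; rewrite negb_or !negbK => /andP[/eqP-> /eqP->]; rewrite subr0.
rewrite (sumFEw le_d) (sumFEw (fsubsetUl _ (dsum_supp y))).
rewrite (sumFEw (fsubsetUr (dsum_supp x) _)) -sumrB.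
by apply: eq_bigr => i _; rewrite !raddfB.
Qed.

Lemma dirsum_lift : exists H : {additive dirsum A -> W},
  forall i (a : A i), H (dsum_in a) = F i a.
Proof.
pose H : {additive dirsum A -> W} :=
  HB.pack sumF (GRing.isZmodMorphism.Build _ _ _ sumF_zmod).
exists H => i a; rewrite /H /= (sumFEw (d := [fset i]%fset)).
  by rewrite big_seq_fset1 coord_in.
apply/fsubsetP => j; rewrite in_dsum_supp inE; apply: contraNT => ji.
by rewrite coord_in_out // eq_sym.
Qed.

End DirectSumLift.

(** * Presentations of direct sums and products *)

Section Combine.
Variable G : groupType.
Local Notation GG := (G * 'Z_4)%type.

Lemma presents_dirsum (I : choiceType) (z : I -> G) (A : I -> zmodType) :
  (forall i, presentable (z i) (A i)) ->
  exists l, presents z (V := dirsum A) l.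
Proof.
move=> /(fun h i => cid (h i)) lP.
pose l i : GG -> A i := projT1 (lP i).
have l_pres i : presents (fun _ : unit => z i) (fun _ => l i) by exact: projT2 (lP i).
exists (fun i a => dsum_in (l i a)); split.
- move=> i; have [lM l_twist] := presents_char (l_pres i) tt.
  by split=> [a b za zb|]; rewrite ?l_twist ?raddf0 // lM // raddfD.
- move=> x; apply: dirsum_eq => i; rewrite raddfD raddf0.
  exact: (presents_exponent2 (l_pres i)).
- move=> W W2 chi chiP.
  have F_ex i : exists F : {additive A i -> W},
      forall a, act (z i) a = z i -> F (l i a) = chi i a.
    have [F FE] := presents_lift (l_pres i) W2 (fun _ => chiP i).
    by exists F => a; exact: (FE tt).
  pose F i := projT1 (cid (F_ex i)).
  have [H HE] := dirsum_lift F.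
  by exists H => i a za; rewrite HE; exact: (projT2 (cid (F_ex i))).
move=> P PS Pl x; rewrite [x]dirsumE; apply: (subgroup_pred_sum PS) => i _.
apply: (presents_gen (l_pres i) (P := fun a => P (dsum_in a))) => [|_ a za].
  by case: PS => P0 PB; split=> [|u v Pu Pv]; rewrite ?raddf0 ?raddfB //; exact: PB.
exact: Pl.
Qed.

Lemma presents_prod (I J : Type) (z : I -> G) (y : J -> G) (V W : zmodType)
    (l : I -> GG -> V) (m : J -> GG -> W) :
  presents z l -> presents y m ->
  exists n, presents (fun k : I + J => match k with inl i => z i | inr j => y j end)
    (V := (V * W)%type) n.
Proof.
move=> lP mP.
exists (fun k a => match k with inl i => (l i a, 0) | inr j => (0, m j a) end).
split.
- case=> i; [have [lM lt] := presents_char lP i|have [lM lt] := presents_char mP i].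
    split=> [a b za zb|]; last by rewrite lt.
    by rewrite lM //; congr (_, _); rewrite addr0.
  split=> [a b za zb|]; last by rewrite lt.
  by rewrite lM //; congr (_, _); rewrite addr0.
- case=> v w; congr (_, _); first exact: (presents_exponent2 lP).
  exact: (presents_exponent2 mP).
- move=> U U2 chi chiP.
  have [F FE] := presents_lift lP U2 (fun i => chiP (inl i)).
  have [H HE] := presents_lift mP U2 (fun j => chiP (inr j)).
  pose K (u : (V * W)%type) := F u.1 + H u.2.
  have K_zmod : zmod_morphism K.
    by move=> u v; rewrite /K !raddfB opprD; exact: addrACA.
  pose Ka : {additive (V * W)%type -> U} :=
    HB.pack K (GRing.isZmodMorphism.Build _ _ _ K_zmod).
  exists Ka; case=> i a za; rewrite /Ka /= /K /=.
    by rewrite raddf0 addr0 FE.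
  by rewrite raddf0 add0r HE.
move=> P PS Pn [v w].
have -> : (v, w) = (v, 0) + (0, w) by congr (_, _); rewrite ?addr0 ?add0r.
have [P0 PB] := PS; apply: (subgroup_predD PS).
  apply: (presents_gen lP (P := fun v => P (v, 0))) => [|i a za].
    split=> // u u' Pu Pu'.
    have -> : (u - u', 0) = (u, 0) - (u', 0) :> (V * W)%type.
      by congr (_, _); rewrite subr0.
    exact: PB.
  exact: (Pn (inl i)).
apply: (presents_gen mP (P := fun w => P (0, w))) => [|j a za].
  split=> // u u' Pu Pu'.
  have -> : (0, u - u') = (0, u) - (0, u') :> (V * W)%type.
    by congr (_, _); rewrite subr0.
  exact: PB.
exact: (Pn (inr j)).
Qed.

End Combine.

(** * Base points for the orbits of the twisted action *)

Lemma cclass_eq (G : groupType) (x y : G) :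
  cclass x = cclass y <-> exists g, y = (x ^ g)%g.
Proof.
split=> [/eqmodP/asboolP//|xy].
by apply/eqmodP/asboolP.
Qed.

(** An orbit of [GG] is the union of a conjugacy class and the class of the inverses. It remains to
    see that S_1, S_2 and S_3^+ together meet each orbit exactly once. *)
Theorem theorem1p17 (G : groupType) (S : conj_class G -> G)
    (S3plus S3minus : set G)
    (S_section : cancel S (@cclass G))
    (S_inv : forall g : G, cclass g <> cclass g^-1%g ->
      S (cclass g^-1%g) = (S (cclass g))^-1%g)
    (S3_cover : S3 S = S3plus `|` S3minus)
    (S3_disjoint : S3plus `&` S3minus = set0)
    (S3_inv : forall z : G, S3plus z <-> S3minus z^-1%g) :
  exists f : {additive HQ1 (grpring 'F_2 G) -> Sigma S S3plus}, bijective f.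
Proof.
have S3plusE z : S3plus z -> S3 S z by rewrite S3_cover; left.
have S1P (z : S1 S) : S1 S (val z) by exact: set_mem (valP z).
have S2P (z : S2 S) : S2 S (val z) by exact: set_mem (valP z).
have S3P (z : S3plus) : S3plus (val z) by exact: set_mem (valP z).
have [l1 l1P] := presents_dirsum (fun z => summand1_presentable (S1P z).2).
have [l2 l2P] := presents_dirsum (fun z => summand2_presentable (S2P z).2).
have [l3 l3P] :=
  presents_dirsum (fun z => summand3_presentable (S3plusE _ (S3P z)).2).
have [l12 l12P] := presents_prod l1P l2P.
have [l lP] := presents_prod l12P l3P.
apply: (hq1_bijection lP) => [w|i j [g k]].
  have [g wE] : exists g, w = (S (cclass w) ^ g)%g.
    by apply/cclass_eq; rewrite S_section.
  have S_range : range S (S (cclass w)) by exists (cclass w).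
  move: (S (cclass w)) wE S_range => z -> z_range.
  have [z1|z1] := pselect (type1 z).
    have z_in : z \in S1 S by apply: mem_set.
    by exists (inl (inl (SigSub z_in))), (g, c4 0).
  have [zz|z3] := pselect (conjugate z z^-1%g).
    have z_in : z \in S2 S by apply: mem_set.
    by exists (inl (inr (SigSub z_in))), (g, c4 0).
  have : S3 S z by [].
  rewrite S3_cover => -[z_plus|z_minus].
    by exists (inr (SigSub (mem_set z_plus))), (g, c4 0).
  (* An element of [S3minus] is reached from its inverse by a flip, hence the label [(g, 1)]. *)
  have z_plus : S3plus z^-1%g by apply/S3_inv; rewrite invgK.
  exists (inr (SigSub (mem_set z_plus))), (g, c4 1).
  by rewrite /act /= conjVg invgK.
pose z (m : S1 S + S2 S + S3plus) : G :=
  match m with inl (inl x) => val x | inl (inr x) => val x | inr x => val x end.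
have zE m : match m with inl x =>
    match x with inl x => val x | inr x => val x end | inr x => val x end = z m.
  by case: m => [[m|m]|m].
rewrite !zE; clear zE.
have z_range m : S (cclass (z m)) = z m.
  suff [c _ <-] : range S (z m) by rewrite S_section.
  case: m => [[m|m]|m]; first by case: (S1P m).
    by case: (S2P m).
  by case: (S3plusE _ (S3P m)).
have z_inj m n : z m = z n -> m = n.
  (* The three types exclude each other, so equal base points lie in the same summand. *)
  have not13 (x : G) : type1 x -> ~ type3 x.
    by move=> x1; apply; rewrite -x1; apply/asboolP; exists 1%g; rewrite conjg1.
  have not12 (x : G) : type1 x -> ~ type2 x by move=> x1 [].
  have not23 (x : G) : type2 x -> ~ type3 x by case=> xx _ x3; exact: x3.
  have t1 x := (S1P x).2; have t2 x := (S2P x).2.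
  have t3 x := (S3plusE _ (S3P x)).2.
  case: m => [[m|m]|m]; case: n => [[n|n]|n]; rewrite /z => mn.
  - by rewrite (val_inj mn).
  - by case: (not12 (val m)); rewrite // mn.
  - by case: (not13 (val m)); rewrite // mn.
  - by case: (not12 (val n)); rewrite // -mn.
  - by rewrite (val_inj mn).
  - by case: (not23 (val m)); rewrite // mn.
  - by case: (not13 (val n)); rewrite // -mn.
  - by case: (not23 (val n)); rewrite // -mn.
  - by rewrite (val_inj mn).
have conj_inj m n : cclass (z m) = cclass (z n) -> m = n.
  by move=> mn; apply: z_inj; rewrite -(z_range m) mn z_range.
rewrite /act /=; case: ifP => _ zij.
  have zj : cclass (z i)^-1%g = cclass (z j).
    by apply/cclass_eq; exists g; rewrite conjVg.
  have [zi|zi] := pselect (cclass (z i) = cclass (z i)^-1%g).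
    by apply: conj_inj; rewrite zi.
  (* The class of [z i] now differs from that of its inverse, so [S] is compatible with inversion
     there. *)
  have zjE : z j = (z i)^-1%g by rewrite -(z_range j) -zj S_inv ?z_range.
  (* Types 1 and 2 are excluded, so [z i] and its inverse [z j] both lie in [S3plus], against
     disjointness from [S3minus]. *)
  have i3 : S3plus (z i).
    case: (i) zi => [[x|x]|x] //= zx; last exact: S3P.
      by case: zx; rewrite -(S1P x).2.
    by case: zx; have [_ [/asboolP zx _]] := S2P x; apply/cclass_eq.
  have j3 : S3plus (z j).
    case: (j) zjE => [[x|x]|x] //= zx; last exact: S3P.
      have x1 := (S1P x).2; case: zi; rewrite -zx; congr cclass.
      by rewrite -[LHS]invgK -zx; exact: esym x1.
    have [_ [/asboolP [h xh] _]] := S2P x; case: zi.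
    by apply/cclass_eq; exists h^-1%g; rewrite -zx -[z i]invgK -zx xh conjgK.
  have /S3_inv : S3plus (z i)^-1%g by rewrite -zjE.
  rewrite invgK => i3'.
  by have : (S3plus `&` S3minus) (z i) by []; rewrite S3_disjoint.
by apply: conj_inj; apply/cclass_eq; exists g.
Qed.
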